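(* Let $f\colon X\to Y$ be a morphism of finite type between Noetherian schemes with $Y$ reduced and non-empty, and let $\mathcal{F}$ be a coherent sheaf on $X$. Then $\mathcal{F}$ is generically flat over $Y$ in the sense that there is a non-empty open subset $U\subseteq Y$ such that $\mathcal{F}|_{f^{-1}U}$ is flat over $U$.
   Context: $\mathcal{F}$ is flat over $Y$ if for every $x\in X$ the stalk $\mathcal{F}_x$ is a flat $\mathcal{O}_{Y,f(x)}$-module. *)

(* Defs.v *)
From HB Require Import structures.
From mathcomp Require Import all_boot all_algebra generic_quotient.
From mathcomp Require Import boolp classical_sets functions topology.
From mathcomp Require Import ring.
From Stdlib Require Import RelationClasses.

Set Implicit Arguments.
Unset Strict Implicit.
Unset Printing Implicit Defensive.

Import GRing.Theory.
Local Open Scope classical_set_scope.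
Local Open Scope ring_scope.
Local Open Scope quotient_scope.

(* Throughout, rings are commutative and possibly zero (comPzRingType): the
   ring of sections over the empty set is the zero ring. *)

Section Quotient.
Context (T : Type) (E : T -> T -> Prop) (EE : Equivalence E).

Let eb : rel {classic T} := fun x y => `[< E x y >].

Lemma quo_rel_proof : equiv_class_of eb.
Proof.
case: EE => r s t; split.
- by move=> x; apply/asboolP.
- by move=> x y; apply/asboolP/asboolP; apply: s.
- by move=> y x z /asboolP xy /asboolP yz; apply/asboolP; apply: t xy yz.
Qed.

Definition quo_rel := EquivRelPack quo_rel_proof.
Definition quo : Type := {eq_quot quo_rel}.
HB.instance Definition _ := Choice.on quo.

Definition cls (x : T) : quo := \pi_({eq_quot quo_rel}) x.
Definition rep (c : quo) : T := repr c.

Lemma repK c : cls (rep c) = c.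
Proof. exact: reprK. Qed.

Lemma clsP x y : cls x = cls y <-> E x y.
Proof.
split=> [/eqP|h]; first by rewrite /cls eqmodE => /asboolP.
by apply/eqP; rewrite /cls eqmodE; apply/asboolP.
Qed.

Lemma repP x : E (rep (cls x)) x.
Proof. by apply/clsP; rewrite repK. Qed.

End Quotient.

Definition is_unit (R : comPzRingType) (r : R) := exists s, r * s = 1.

Definition is_ideal (R : comPzRingType) (I : set R) :=
  [/\ I 0, forall a b, I a -> I b -> I (a + b) & forall a b, I b -> I (a * b)].

Definition is_prime_ideal (R : comPzRingType) (p : set R) :=
  [/\ is_ideal p, ~ p 1 & forall a b, p (a * b) -> p a \/ p b].

Definition noetherian_ring (R : comPzRingType) :=
  forall I : set R, is_ideal I ->
    exists (n : nat) (g : 'I_n -> R),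
      I = [set x | exists c : 'I_n -> R, x = \sum_(i < n) c i * g i].

(* S is generated as an R-algebra by finitely many elements *)
Definition finite_type_ring (R S : comPzRingType) (phi : {rmorphism R -> S}) :=
  exists (n : nat) (g : 'I_n -> S), forall B : set S,
    (forall r, B (phi r)) -> (forall i, B (g i)) ->
    (forall a b, B a -> B b -> B (a + b)) ->
    (forall a b, B a -> B b -> B (a * b)) -> forall a, B a.

Definition rscal (R S : comPzRingType) (phi : {rmorphism R -> S})
  (M : lmodType S) : Type := M.

Section RestrictScalars.
Context (R S : comPzRingType) (phi : {rmorphism R -> S}) (M : lmodType S).

HB.instance Definition _ := GRing.Zmodule.copy (rscal phi M) M.

Definition rscal_scale (r : R) (m : rscal phi M) : rscal phi M :=
  phi r *: (m : M).

Lemma rscal_scaleA a b v :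
  rscal_scale a (rscal_scale b v) = rscal_scale (a * b) v.
Proof. by rewrite /rscal_scale rmorphM scalerA. Qed.
Lemma rscal_scale1 : left_id 1 rscal_scale.
Proof. by move=> v; rewrite /rscal_scale rmorph1 scale1r. Qed.
Lemma rscal_scaleDr : right_distributive rscal_scale +%R.
Proof. by move=> a u v; rewrite /rscal_scale scalerDr. Qed.
Lemma rscal_scaleDl v : {morph rscal_scale^~ v : a b / a + b}.
Proof. by move=> a b; rewrite /rscal_scale rmorphD scalerDl. Qed.

HB.instance Definition _ := GRing.Zmodule_isLmodule.Build R (rscal phi M)
  rscal_scaleA rscal_scale1 rscal_scaleDr rscal_scaleDl.
End RestrictScalars.

Section Tensor.
Context (R : comPzRingType).

(* A list [:: (m1, n1); ...; (mk, nk)] stands for the sum of the mi (x) ni;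
   M (x)_R N is the quotient of lists by the congruence below.  No inverses are
   needed in the generators, since (- m) (x) n is the opposite of m (x) n. *)
Inductive tensor_rel (M N : lmodType R) :
    seq (M * N) -> seq (M * N) -> Prop :=
| tensor_refl s : tensor_rel s s
| tensor_sym s t : tensor_rel s t -> tensor_rel t s
| tensor_trans s t u : tensor_rel s t -> tensor_rel t u -> tensor_rel s u
| tensor_cat s s' t t' :
    tensor_rel s s' -> tensor_rel t t' -> tensor_rel (s ++ t) (s' ++ t')
| tensor_comm s t : tensor_rel (s ++ t) (t ++ s)
| tensor_zero n : tensor_rel [:: (0, n)] [::]
| tensor_addl m m' n : tensor_rel [:: (m + m', n)] [:: (m, n); (m', n)]
| tensor_addr m n n' : tensor_rel [:: (m, n + n')] [:: (m, n); (m, n')]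
| tensor_scale r m n : tensor_rel [:: (r *: m, n)] [:: (m, r *: n)].

Lemma tensor_equiv (M N : lmodType R) : Equivalence (@tensor_rel M N).
Proof.
split; [exact: tensor_refl | exact: tensor_sym | exact: tensor_trans].
Qed.

Definition tensor (M N : lmodType R) := quo (tensor_equiv M N).

(* f (x) id_M; well defined by tensor_mapE *)
Definition tensor_map (N N' M : lmodType R) (f : {linear N -> N'})
    (z : tensor N M) : tensor N' M :=
  cls _ [seq (f u.1, u.2) | u <- rep z].

Lemma tensor_mapE (N N' M : lmodType R) (f : {linear N -> N'})
    (s : seq (N * M)) :
  tensor_map f (cls (tensor_equiv N M) s)
  = cls (tensor_equiv N' M) [seq (f u.1, u.2) | u <- s].
Proof.
apply/clsP; move: (rep _) (repP (tensor_equiv N M) s) => s0.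
elim=> {s s0} => [s|s t _|s t u _ h _|s s' t t' _ h _ h'|s t|n|m m' n|m n n'|r m n].
- exact: tensor_refl.
- exact: tensor_sym.
- exact: tensor_trans h.
- by rewrite !map_cat; apply: tensor_cat.
- by rewrite !map_cat; apply: tensor_comm.
- by rewrite /= linear0; apply: tensor_zero.
- by rewrite /= linearD; apply: tensor_addl.
- exact: tensor_addr.
- by rewrite /= linearZ; apply: tensor_scale.
Qed.

Definition flat (M : lmodType R) :=
  forall (N N' : lmodType R) (f : {linear N -> N'}),
    injective f -> injective (@tensor_map N N' M f).

End Tensor.

Record opens (X : topologicalType) := Opens {
  oset :> set X;
  open_oset : open oset
}.

Definition opensI (X : topologicalType) (U V : opens X) : opens X :=
  Opens (openI (open_oset U) (open_oset V)).

Lemma opensIl (X : topologicalType) (U V : opens X) : opensI U V `<=` U.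
Proof. exact: subIsetl. Qed.

Lemma opensIr (X : topologicalType) (U V : opens X) : opensI U V `<=` V.
Proof. exact: subIsetr. Qed.

Definition opreim (X Y : topologicalType) (f : X -> Y) (fc : continuous f)
    (V : opens Y) : opens X :=
  Opens (open_comp (fun x _ => fc x) (open_oset V) : open (f @^-1` V)).

Record presheaf (X : topologicalType) := Presheaf {
  psec :> opens X -> Type;
  pres : forall U V : opens X, V `<=` U -> psec U -> psec V;
  pres_id : forall (U : opens X) (h : U `<=` U) (s : psec U), pres h s = s;
  pres_comp : forall (U V W : opens X) (h : V `<=` U) (h' : W `<=` V)
    (h'' : W `<=` U) (s : psec U), pres h' (pres h s) = pres h'' s
}.

Definition is_sheaf (X : topologicalType) (P : presheaf X) :=
  forall (U : opens X) (I : Type) (V : I -> opens X)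
    (VU : forall i, V i `<=` U),
    U `<=` \bigcup_i V i ->
    forall s : forall i, P (V i),
      (forall i j, pres (@opensIl _ (V i) (V j)) (s i)
                 = pres (@opensIr _ (V i) (V j)) (s j)) ->
      exists! t : P U, forall i, pres (VU i) t = s i.

Section Stalk.
Context (X : topologicalType).
Implicit Types (P Q T : presheaf X) (x : X).

Record pregerm P x := Pregerm {
  gdom : opens X;
  gmem : oset gdom x;
  gsec : P gdom
}.

Definition germ_rel P x (g h : pregerm P x) :=
  exists (W : opens X) (Wg : W `<=` gdom g) (Wh : W `<=` gdom h),
    oset W x /\ pres Wg (gsec g) = pres Wh (gsec h).

Lemma germ_equiv P x : Equivalence (@germ_rel P x).
Proof.
split.
- by move=> [U Ux s]; exists U, (@subset_refl _ U), (@subset_refl _ U).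
- by move=> g h [W [Wg [Wh [Wx e]]]]; exists W, Wh, Wg.
- move=> [U Ux s] [V Vx t] [W Wx u] [A [/= AU [AV [Ax e]]]].
  move=> [B [/= BV [BW [Bx e']]]].
  have CA : opensI A B `<=` A by apply: subIsetl.
  have CB : opensI A B `<=` B by apply: subIsetr.
  exists (opensI A B), (subset_trans CA AU), (subset_trans CB BW); split=> //=.
  rewrite -(pres_comp AU CA) e -(pres_comp BW CB) -e'.
  by rewrite !(pres_comp _ _ (subset_trans CA AV)).
Qed.

Definition stalk P x := quo (germ_equiv P x).

Definition germ P x (U : opens X) (Ux : oset U x) (s : P U) : stalk P x :=
  cls _ (Pregerm Ux s).

Lemma germP P x U V (Ux : oset U x) (Vx : oset V x) (s : P U) (t : P V) :
  germ Ux s = germ Vx t <->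
  exists (W : opens X) (WU : W `<=` U) (WV : W `<=` V),
    oset W x /\ pres WU s = pres WV t.
Proof. exact: clsP. Qed.

Lemma germ_res P x (U V : opens X) (h : V `<=` U) (Ux : oset U x) (Vx : oset V x)
  (s : P U) : germ Vx (pres h s) = germ Ux s.
Proof. by apply/germP; exists V, (@subset_refl _ V), h; rewrite pres_id. Qed.

Lemma stalkP P x (a : stalk P x) : exists U (Ux : oset U x) (s : P U), a = germ Ux s.
Proof.
by rewrite -(repK a); case: (rep a) => U Ux s; exists U, Ux, s.
Qed.

Lemma stalkP2 P Q x (a : stalk P x) (b : stalk Q x) :
  exists U (Ux : oset U x) (s : P U) (t : Q U), a = germ Ux s /\ b = germ Ux t.
Proof.
have [U [Ux [s ->]]] := stalkP a; have [V [Vx [t ->]]] := stalkP b.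
have hU : opensI U V `<=` U by apply: subIsetl.
have hV : opensI U V `<=` V by apply: subIsetr.
have Wx : oset (opensI U V) x by [].
by exists (opensI U V), Wx, (pres hU s), (pres hV t); rewrite !germ_res.
Qed.

Lemma stalkP3 P Q x (a : stalk P x) (b c : stalk Q x) :
  exists U (Ux : oset U x) (s : P U) (t u : Q U),
    [/\ a = germ Ux s, b = germ Ux t & c = germ Ux u].
Proof.
have [U [Ux [s [t [-> ->]]]]] := stalkP2 a b.
have [V [Vx [u ->]]] := stalkP c.
have hU : opensI U V `<=` U by apply: subIsetl.
have hV : opensI U V `<=` V by apply: subIsetr.
have Wx : oset (opensI U V) x by [].
exists (opensI U V), Wx, (pres hU s), (pres hU t), (pres hV u).
by rewrite !germ_res.
Qed.

(* The operations induced on stalks by operations on sections; the lemmas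
   stalk_op1E and stalk_op2E give their values when the latter commute with
   restriction. *)
Definition stalk_op1 P Q x (op : forall U, P U -> Q U) (a : stalk P x) :
    stalk Q x :=
  germ (gmem (rep a)) (op _ (gsec (rep a))).

Definition stalk_op2 P Q T x (op : forall U, P U -> Q U -> T U)
    (a : stalk P x) (b : stalk Q x) : stalk T x :=
  let g := rep a in let h := rep b in
  germ (conj (gmem g) (gmem h) : oset (opensI (gdom g) (gdom h)) x)
    (op _ (pres (@opensIl _ _ _) (gsec g)) (pres (@opensIr _ _ _) (gsec h))).

Lemma stalk_op1E P Q x (op : forall U, P U -> Q U) :
  (forall (U V : opens X) (h : V `<=` U) s, pres h (op U s) = op V (pres h s)) ->
  forall U (Ux : oset U x) s, stalk_op1 op (germ Ux s) = germ Ux (op U s).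
Proof.
move=> nat U Ux s; rewrite /stalk_op1.
have [] := repP (germ_equiv P x) (Pregerm Ux s).
move=> W [Wg [Wh [Wx e]]]; apply/germP; exists W, Wg, Wh; split=> //.
by rewrite !nat e.
Qed.

Lemma stalk_op2E P Q T x (op : forall U, P U -> Q U -> T U) :
  (forall (U V : opens X) (h : V `<=` U) s t,
    pres h (op U s t) = op V (pres h s) (pres h t)) ->
  forall U (Ux : oset U x) s t,
    stalk_op2 op (germ Ux s) (germ Ux t) = germ Ux (op U s t).
Proof.
move=> nat U Ux s t; rewrite /stalk_op2.
have [] := repP (germ_equiv P x) (Pregerm Ux s).
have [] := repP (germ_equiv Q x) (Pregerm Ux t).
rewrite -!/(germ _ _).
move: (rep (germ Ux s)) (rep (germ Ux t)) => [A Ax a] [B Bx b] /=.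
move=> V [VB [/= VU [Vx e]]] W [WA [/= WU [Wx e']]].
have CV : opensI V W `<=` V by apply: subIsetl.
have CW : opensI V W `<=` W by apply: subIsetr.
have CAB : opensI V W `<=` opensI A B.
  by move=> z [/VB Bz /WA Az].
apply/germP; exists (opensI V W), CAB, (subset_trans CV VU); split=> //.
rewrite !nat; congr (op _ _ _).
- rewrite (pres_comp _ _ (subset_trans CW WA)) -(pres_comp WA CW) e'.
  exact: pres_comp.
- rewrite (pres_comp _ _ (subset_trans CV VB)) -(pres_comp VB CV) e.
  exact: pres_comp.
Qed.

End Stalk.

Record ringedSpace := RingedSpace {
  rs_space :> topologicalType;
  rs_sec : opens rs_space -> comPzRingType;
  rs_res : forall U V : opens rs_space,
    V `<=` U -> {rmorphism rs_sec U -> rs_sec V};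
  rs_res_id : forall (U : opens rs_space) (h : U `<=` U) (s : rs_sec U),
    rs_res h s = s;
  rs_res_comp : forall (U V W : opens rs_space) (h : V `<=` U) (h' : W `<=` V)
    (h'' : W `<=` U) (s : rs_sec U), rs_res h' (rs_res h s) = rs_res h'' s;
  rs_sheaf : is_sheaf (Presheaf rs_res_id rs_res_comp)
}.
Arguments rs_sec {r}.
Arguments rs_res {r U V}.

Notation "''O'" := rs_sec (at level 0) : ring_scope.

Definition O_presheaf (X : ringedSpace) : presheaf X :=
  Presheaf (@rs_res_id X) (@rs_res_comp X).

Record omodule (X : ringedSpace) := OModule {
  om_sec :> forall U : opens X, lmodType ('O U);
  om_res : forall U V : opens X, V `<=` U -> {additive om_sec U -> om_sec V};
  om_resZ : forall (U V : opens X) (h : V `<=` U) (a : 'O U) (s : om_sec U),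
    om_res h (a *: s) = rs_res h a *: om_res h s;
  om_res_id : forall (U : opens X) (h : U `<=` U) (s : om_sec U),
    om_res h s = s;
  om_res_comp : forall (U V W : opens X) (h : V `<=` U) (h' : W `<=` V)
    (h'' : W `<=` U) (s : om_sec U), om_res h' (om_res h s) = om_res h'' s;
  om_sheaf : is_sheaf (Presheaf om_res_id om_res_comp)
}.
Arguments om_res {X} o {U V}.

Definition om_presheaf (X : ringedSpace) (F : omodule X) : presheaf X :=
  Presheaf (@om_res_id X F) (@om_res_comp X F).

Section RingStalk.
Context (X : ringedSpace) (x : X).

Definition ostalk : Type := stalk (O_presheaf X) x.
HB.instance Definition _ := Choice.on ostalk.

Definition ogerm (U : opens X) (Ux : oset U x) (s : 'O U) : ostalk :=
  @germ X (O_presheaf X) x U Ux s.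

Definition ostalk_add : ostalk -> ostalk -> ostalk :=
  @stalk_op2 X (O_presheaf X) (O_presheaf X) (O_presheaf X) x
    (fun U (s t : 'O U) => s + t).
Definition ostalk_mul : ostalk -> ostalk -> ostalk :=
  @stalk_op2 X (O_presheaf X) (O_presheaf X) (O_presheaf X) x
    (fun U (s t : 'O U) => s * t).
Definition ostalk_opp : ostalk -> ostalk :=
  @stalk_op1 X (O_presheaf X) (O_presheaf X) x (fun U (s : 'O U) => - s).

Definition oT : opens X := Opens openT.
Definition ostalk_zero : ostalk := @ogerm oT I 0.
Definition ostalk_one : ostalk := @ogerm oT I 1.

Lemma ostalk_addE U (Ux : oset U x) (s t : 'O U) :
  ostalk_add (ogerm Ux s) (ogerm Ux t) = ogerm Ux (s + t).
Proof.
apply: (@stalk_op2E X (O_presheaf X) (O_presheaf X) (O_presheaf X) x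
  (fun U (s t : 'O U) => s + t)) => V W h a b.
exact: rmorphD.
Qed.

Lemma ostalk_mulE U (Ux : oset U x) (s t : 'O U) :
  ostalk_mul (ogerm Ux s) (ogerm Ux t) = ogerm Ux (s * t).
Proof.
apply: (@stalk_op2E X (O_presheaf X) (O_presheaf X) (O_presheaf X) x
  (fun U (s t : 'O U) => s * t)) => V W h a b.
exact: rmorphM.
Qed.

Lemma ostalk_oppE U (Ux : oset U x) (s : 'O U) :
  ostalk_opp (ogerm Ux s) = ogerm Ux (- s).
Proof.
apply: (@stalk_op1E X (O_presheaf X) (O_presheaf X) x
  (fun U (s : 'O U) => - s)) => V W h a.
exact: rmorphN.
Qed.

Lemma ogerm_res (U V : opens X) (h : V `<=` U) (Ux : oset U x) (Vx : oset V x)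
  (s : 'O U) : ogerm Vx (rs_res h s) = ogerm Ux s.
Proof. exact: (@germ_res X (O_presheaf X)). Qed.

Lemma ostalk_zeroE U (Ux : oset U x) : ostalk_zero = ogerm Ux 0.
Proof.
have h : U `<=` oT by [].
by rewrite /ostalk_zero -(ogerm_res h I Ux) rmorph0.
Qed.

Lemma ostalk_oneE U (Ux : oset U x) : ostalk_one = ogerm Ux 1.
Proof.
have h : U `<=` oT by [].
by rewrite /ostalk_one -(ogerm_res h I Ux) rmorph1.
Qed.

Lemma ostalk_addA : associative ostalk_add.
Proof.
move=> a b c; have [U [Ux [s [t [u [-> -> ->]]]]]] := stalkP3 a b c.
by rewrite !ostalk_addE addrA.
Qed.
Lemma ostalk_addC : commutative ostalk_add.
Proof.
move=> a b; have [U [Ux [s [t [-> ->]]]]] := stalkP2 a b.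
by rewrite !ostalk_addE addrC.
Qed.
Lemma ostalk_add0 : left_id ostalk_zero ostalk_add.
Proof.
move=> a; have [U [Ux [s ->]]] := stalkP a.
by rewrite (ostalk_zeroE Ux) ostalk_addE add0r.
Qed.
Lemma ostalk_addN : left_inverse ostalk_zero ostalk_opp ostalk_add.
Proof.
move=> a; have [U [Ux [s ->]]] := stalkP a.
by rewrite (ostalk_zeroE Ux) ostalk_oppE ostalk_addE addNr.
Qed.
HB.instance Definition _ := GRing.isZmodule.Build ostalk
  ostalk_addA ostalk_addC ostalk_add0 ostalk_addN.

Lemma ostalk_mulA : associative ostalk_mul.
Proof.
move=> a b c; have [U [Ux [s [t [u [-> -> ->]]]]]] := stalkP3 a b c.
by rewrite !ostalk_mulE mulrA.
Qed.
Lemma ostalk_mulC : commutative ostalk_mul.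
Proof.
move=> a b; have [U [Ux [s [t [-> ->]]]]] := stalkP2 a b.
by rewrite !ostalk_mulE mulrC.
Qed.
Lemma ostalk_mul1 : left_id ostalk_one ostalk_mul.
Proof.
move=> a; have [U [Ux [s ->]]] := stalkP a.
by rewrite (ostalk_oneE Ux) ostalk_mulE mul1r.
Qed.
Lemma ostalk_mulDl : left_distributive ostalk_mul ostalk_add.
Proof.
move=> a b c; have [U [Ux [s [t [u [-> -> ->]]]]]] := stalkP3 a b c.
by rewrite !(ostalk_mulE, ostalk_addE) mulrDl.
Qed.
HB.instance Definition _ := GRing.Zmodule_isComPzRing.Build ostalk
  ostalk_mulA ostalk_mulC ostalk_mul1 ostalk_mulDl.

End RingStalk.

Section ModuleStalk.
Context (X : ringedSpace) (F : omodule X) (x : X).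

Definition mstalk : Type := stalk (om_presheaf F) x.
HB.instance Definition _ := Choice.on mstalk.

Definition mgerm (U : opens X) (Ux : oset U x) (s : F U) : mstalk :=
  @germ X (om_presheaf F) x U Ux s.

Definition mstalk_add : mstalk -> mstalk -> mstalk :=
  @stalk_op2 X (om_presheaf F) (om_presheaf F) (om_presheaf F) x
    (fun U (s t : F U) => s + t).
Definition mstalk_opp : mstalk -> mstalk :=
  @stalk_op1 X (om_presheaf F) (om_presheaf F) x (fun U (s : F U) => - s).
Definition mstalk_scale : ostalk x -> mstalk -> mstalk :=
  @stalk_op2 X (O_presheaf X) (om_presheaf F) (om_presheaf F) x
    (fun U (a : 'O U) (s : F U) => a *: s).
Definition mstalk_zero : mstalk := @mgerm (oT X) I 0.

Lemma mstalk_addE U (Ux : oset U x) (s t : F U) :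
  mstalk_add (mgerm Ux s) (mgerm Ux t) = mgerm Ux (s + t).
Proof.
apply: (@stalk_op2E X (om_presheaf F) (om_presheaf F) (om_presheaf F) x
  (fun U (s t : F U) => s + t)) => V W h a b.
exact: raddfD.
Qed.

Lemma mstalk_oppE U (Ux : oset U x) (s : F U) :
  mstalk_opp (mgerm Ux s) = mgerm Ux (- s).
Proof.
apply: (@stalk_op1E X (om_presheaf F) (om_presheaf F) x
  (fun U (s : F U) => - s)) => V W h a.
exact: raddfN.
Qed.

Lemma mstalk_scaleE U (Ux : oset U x) (a : 'O U) (s : F U) :
  mstalk_scale (ogerm Ux a) (mgerm Ux s) = mgerm Ux (a *: s).
Proof.
apply: (@stalk_op2E X (O_presheaf X) (om_presheaf F) (om_presheaf F) x
  (fun U (a : 'O U) (s : F U) => a *: s)) => V W h b t.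
exact: om_resZ.
Qed.

Lemma mgerm_res (U V : opens X) (h : V `<=` U) (Ux : oset U x) (Vx : oset V x)
  (s : F U) : mgerm Vx (om_res F h s) = mgerm Ux s.
Proof. exact: (@germ_res X (om_presheaf F)). Qed.

Lemma mstalk_zeroE U (Ux : oset U x) : mstalk_zero = mgerm Ux 0.
Proof.
have h : U `<=` oT X by [].
by rewrite /mstalk_zero -(mgerm_res h I Ux) raddf0.
Qed.

Lemma mstalk_addA : associative mstalk_add.
Proof.
move=> a b c; have [U [Ux [s [t [u [-> -> ->]]]]]] := stalkP3 a b c.
by rewrite !mstalk_addE addrA.
Qed.
Lemma mstalk_addC : commutative mstalk_add.
Proof.
move=> a b; have [U [Ux [s [t [-> ->]]]]] := stalkP2 a b.
by rewrite !mstalk_addE addrC.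
Qed.
Lemma mstalk_add0 : left_id mstalk_zero mstalk_add.
Proof.
move=> a; have [U [Ux [s ->]]] := stalkP a.
by rewrite (mstalk_zeroE Ux) mstalk_addE add0r.
Qed.
Lemma mstalk_addN : left_inverse mstalk_zero mstalk_opp mstalk_add.
Proof.
move=> a; have [U [Ux [s ->]]] := stalkP a.
by rewrite (mstalk_zeroE Ux) mstalk_oppE mstalk_addE addNr.
Qed.
HB.instance Definition _ := GRing.isZmodule.Build mstalk
  mstalk_addA mstalk_addC mstalk_add0 mstalk_addN.

Lemma mstalk_scaleA a b v :
  mstalk_scale a (mstalk_scale b v) = mstalk_scale (ostalk_mul a b) v.
Proof.
have [U [Ux [s [t [u [-> -> ->]]]]]] := stalkP3 v a b.
by rewrite ostalk_mulE !mstalk_scaleE scalerA.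
Qed.
Lemma mstalk_scale1 : left_id (ostalk_one x) mstalk_scale.
Proof.
move=> a; have [U [Ux [s ->]]] := stalkP a.
by rewrite (ostalk_oneE Ux) mstalk_scaleE scale1r.
Qed.
Lemma mstalk_scaleDr : right_distributive mstalk_scale mstalk_add.
Proof.
move=> a b c; have [U [Ux [s [t [u [-> -> ->]]]]]] := stalkP3 a b c.
by rewrite !(mstalk_addE, mstalk_scaleE) scalerDr.
Qed.
Lemma mstalk_scaleDl v :
  {morph mstalk_scale^~ v : a b / ostalk_add a b >-> mstalk_add a b}.
Proof.
move=> a b; have [U [Ux [s [t [u [-> -> ->]]]]]] := stalkP3 v a b.
by rewrite ostalk_addE !mstalk_scaleE mstalk_addE scalerDl.
Qed.
HB.instance Definition _ := GRing.Zmodule_isLmodule.Build (ostalk x) mstalk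
  mstalk_scaleA mstalk_scale1 mstalk_scaleDr mstalk_scaleDl.

End ModuleStalk.

Record rsMorphism (X Y : ringedSpace) := RsMorphism {
  rm_fun :> X -> Y;
  rm_cont : continuous rm_fun;
  rm_sharp : forall V : opens Y, {rmorphism 'O V -> 'O (opreim rm_cont V)};
  rm_nat : forall (V W : opens Y) (h : W `<=` V)
    (h' : opreim rm_cont W `<=` opreim rm_cont V) (s : 'O V),
    rs_res h' (rm_sharp V s) = rm_sharp W (rs_res h s)
}.

Arguments rm_cont {X Y} r.
Arguments rm_sharp {X Y} r V.

Definition rm_preim (X Y : ringedSpace) (f : rsMorphism X Y) :
    opens Y -> opens X :=
  opreim (rm_cont f).

Section StalkMap.
Context (X Y : ringedSpace) (f : rsMorphism X Y) (x : X).

Definition stalk_map (a : ostalk (f x)) : ostalk x :=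
  let g := rep a in
  @ogerm X x (rm_preim f (gdom g)) (gmem g) (rm_sharp f (gdom g) (gsec g)).

Lemma stalk_mapE U (Ux : oset U (f x)) (s : 'O U) :
  stalk_map (ogerm Ux s) = @ogerm X x (rm_preim f U) Ux (rm_sharp f U s).
Proof.
rewrite /stalk_map /ogerm.
have [] := repP (germ_equiv (O_presheaf Y) (f x)) (Pregerm Ux (s : O_presheaf Y U)).
rewrite -/(@germ _ (O_presheaf Y) _ _ Ux s).
move: (rep _) => [A Ax a] W [/= WA [WU [Wx e]]]; apply/germP.
have WA' : rm_preim f W `<=` rm_preim f A by move=> z /WA.
have WU' : rm_preim f W `<=` rm_preim f U by move=> z /WU.
exists (rm_preim f W), WA', WU'; split=> //=.
by rewrite (rm_nat WA) (rm_nat WU) [rs_res WA a]e.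
Qed.

Lemma stalk_map_zmod : zmod_morphism stalk_map.
Proof.
move=> a b.
change (stalk_map (ostalk_add a (ostalk_opp b))
  = ostalk_add (stalk_map a) (ostalk_opp (stalk_map b))).
have [U [Ux [s [t [-> ->]]]]] := stalkP2 a b.
rewrite ostalk_oppE ostalk_addE !stalk_mapE ostalk_oppE ostalk_addE.
by rewrite rmorphB.
Qed.

Lemma stalk_map_monoid : monoid_morphism stalk_map.
Proof.
split=> [|a b].
  by rewrite [LHS]stalk_mapE rmorph1 -ostalk_oneE.
change (stalk_map (ostalk_mul a b) = ostalk_mul (stalk_map a) (stalk_map b)).
have [U [Ux [s [t [-> ->]]]]] := stalkP2 a b.
by rewrite ostalk_mulE !stalk_mapE ostalk_mulE rmorphM.
Qed.

HB.instance Definition _ :=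
  GRing.isZmodMorphism.Build (ostalk (f x)) (ostalk x) stalk_map stalk_map_zmod.
HB.instance Definition _ :=
  GRing.isMonoidMorphism.Build (ostalk (f x)) (ostalk x) stalk_map
    stalk_map_monoid.

End StalkMap.
Arguments stalk_map {X Y} f x.

Definition is_iso (X Y : ringedSpace) (f : rsMorphism X Y) :=
  [/\ bijective f,
      forall U : set X, open U -> open (f @` U)
    & forall V : opens Y, bijective (rm_sharp f V)].

Definition flat_over (X Y : ringedSpace) (f : rsMorphism X Y) (F : omodule X) :=
  forall x : X, flat (rscal (stalk_map f x) (mstalk F x)).

Section Restrict.
Context (X : ringedSpace) (U : opens X).

Lemma oimage_open (V : opens (set_type U)) : open (set_val @` V).
Proof.
have [V' V'o e] : @initial_topology.wopen _ _ (set_val : U -> X) V.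
  exact: (open_oset V).
suff -> : set_val @` V = V' `&` U by apply: openI => //; exact: open_oset.
apply/seteqP; split=> [y [z Vz <-]|y [V'y Uy]].
  split; last exact/set_mem/(valP z).
  by have : (set_val @^-1` V') z by rewrite e.
exists (exist _ y (mem_set Uy) : U) => //.
by rewrite -e.
Qed.

Definition oimage (V : opens (set_type U)) : opens X := Opens (oimage_open V).

Lemma oimageS (V W : opens (set_type U)) :
  W `<=` V -> oimage W `<=` oimage V.
Proof. exact: image_subset. Qed.

Lemma oimageK (V : opens (set_type U)) z : oset (oimage V) (set_val z) -> oset V z.
Proof. by move=> [y Vy /val_inj <-]. Qed.

Definition restrict_presheaf (P : presheaf X) : presheaf (set_type U) :=
  @Presheaf _ (fun V => P (oimage V)) (fun V W h => pres (oimageS h))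
    (fun V h => pres_id (oimageS h))
    (fun V1 V2 V3 h h' h'' => pres_comp (oimageS h) (oimageS h') (oimageS h'')).

Lemma restrict_sheaf (P : presheaf X) :
  is_sheaf P -> is_sheaf (restrict_presheaf P).
Proof.
move=> Psh V I W WV cov s comp.
apply: (Psh (oimage V) I (fun i => oimage (W i)) (fun i => oimageS (WV i))).
  by move=> y [z /cov [i _ Wz] <-]; exists i => //; exists z.
move=> i j.
have h : opensI (oimage (W i)) (oimage (W j)) `<=` oimage (opensI (W i) (W j)).
  by move=> y [[z Wz <-]] /oimageK Wz'; exists z.
have /(congr1 (pres h)) := comp i j.
by rewrite /= !(pres_comp _ _ (@opensIl _ _ _)) !(pres_comp _ _ (@opensIr _ _ _)).
Qed.

Definition restrict : ringedSpace :=
  @RingedSpace (set_type U) (fun V => 'O (oimage V))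
    (fun V W h => rs_res (oimageS h))
    (fun V h => rs_res_id (oimageS h))
    (fun V1 V2 V3 h h' h'' => rs_res_comp (oimageS h) (oimageS h') (oimageS h''))
    (restrict_sheaf (@rs_sheaf X)).

Definition restrict_mod (F : omodule X) : omodule restrict :=
  @OModule restrict (fun V => F (oimage V))
    (fun V W h => om_res F (oimageS h))
    (fun V W h => om_resZ (oimageS h))
    (fun V h => om_res_id (oimageS h))
    (fun V1 V2 V3 h h' h'' => om_res_comp (oimageS h) (oimageS h') (oimageS h''))
    (restrict_sheaf (@om_sheaf X F)).

End Restrict.

Section RestrictMorphism.
Context (X Y : ringedSpace) (f : rsMorphism X Y) (U : opens Y).

Definition restrict_fun (x : restrict (rm_preim f U)) : restrict U :=
  exist _ (f (set_val x)) (mem_set (set_mem (valP x) : oset U (f (set_val x)))).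

Lemma restrict_fun_cont : continuous restrict_fun.
Proof.
apply/continuousP => _ [V Vo <-].
exists (f @^-1` V) => //.
by apply: open_comp Vo => z _; exact: rm_cont.
Qed.

Lemma restrict_preim (V : opens (restrict U)) :
  oimage (opreim restrict_fun_cont V) `<=` rm_preim f (oimage V).
Proof. by move=> _ [z Vz <-]; exists (restrict_fun z). Qed.

Definition restrict_sharp (V : opens (restrict U)) :
    {rmorphism ('O V : comPzRingType) -> 'O (opreim restrict_fun_cont V)} :=
  rs_res (@restrict_preim V) \o rm_sharp f (oimage V).

Lemma restrict_nat (V W : opens (restrict U)) (h : W `<=` V)
  (h' : opreim restrict_fun_cont W `<=` opreim restrict_fun_cont V)
  (s : 'O V) :
  rs_res h' (restrict_sharp V s) = restrict_sharp W (rs_res h s).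
Proof.
rewrite /=.
have k : rm_preim f (oimage W) `<=` rm_preim f (oimage V).
  by move=> z /(oimageS h).
rewrite -(rm_nat (oimageS h) k) /=.
rewrite (rs_res_comp _ _ (subset_trans (@restrict_preim W) k)).
by rewrite (rs_res_comp _ _ (subset_trans (@restrict_preim W) k)).
Qed.

Definition restrict_mor : rsMorphism (restrict (rm_preim f U)) (restrict U) :=
  RsMorphism restrict_nat.

End RestrictMorphism.

Section Spec.
Context (A : comPzRingType).

Record spec := Spec {
  spec_ideal :> set A;
  spec_prime : is_prime_ideal spec_ideal
}.
HB.instance Definition _ := gen_eqMixin spec.
HB.instance Definition _ := gen_choiceMixin spec.

(* the complements of the closed sets V(E), E a subset of A *)
Definition zariski_open : set (set spec) :=
  [set U | exists E : set A, U = [set p : spec | ~ E `<=` p]].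

Lemma zariskiT : zariski_open setT.
Proof.
exists setT; apply/seteqP; split=> // p _ /= h.
by case: (spec_prime p) => _ + _; apply; apply: h.
Qed.

Lemma zariskiI : setI_closed zariski_open.
Proof.
move=> _ _ [E ->] [E' ->].
exists [set x | exists a b, [/\ E a, E' b & x = a * b]].
apply/seteqP; split=> p /=; have [[p0 pD pM] p1 pP] := spec_prime p.
  move=> [/existsNP[a /not_implyP[Ea pa]] /existsNP[b /not_implyP[Eb pb]]] h.
  by have /pP[] : (p : set A) (a * b) by apply: h; exists a, b.
move=> h; split=> h'; apply: h => _ [a [b [Ea Eb ->]]].
  by rewrite mulrC; apply: pM; apply: h'.
by apply: pM; apply: h'.
Qed.

Lemma zariski_bigU (I : Type) (f : I -> set spec) :
  (forall i, zariski_open (f i)) -> zariski_open (\bigcup_i f i).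
Proof.
move=> fo; exists [set a | exists i E,
  f i = [set p : spec | ~ E `<=` p] /\ E a].
apply/seteqP; split=> p /=.
  move=> [i _ fip] h; have [E fE] := fo i; move: (fip); rewrite fE; apply.
  by move=> a Ea; apply: h; exists i, E.
move=> /existsNP[a /not_implyP[[i [E [fE Ea]]] pa]].
by exists i => //; rewrite fE => h; apply: pa; apply: h.
Qed.

HB.instance Definition _ :=
  isOpenTopological.Build spec zariskiT zariskiI zariski_bigU.

Section Localization.
Context (p : spec).

Record prefrac := Prefrac {
  fnum : A;
  fden : A;
  fdenP : ~ (p : set A) fden
}.

Definition frac_rel (x y : prefrac) :=
  exists t, ~ (p : set A) t /\ t * (fnum x * fden y) = t * (fnum y * fden x).

Lemma spec_mulN a b :
  ~ (p : set A) a -> ~ (p : set A) b -> ~ (p : set A) (a * b).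
Proof. by have [_ _ pP] := spec_prime p => pa pb /pP[]. Qed.

Lemma spec_1N : ~ (p : set A) 1.
Proof. by have [_ p1 _] := spec_prime p. Qed.

Lemma frac_equiv : Equivalence frac_rel.
Proof.
split.
- by move=> x; exists 1; split=> //; exact: spec_1N.
- by move=> x y [t [pt e]]; exists t.
- move=> [a f pf] [b g pg] [c h ph] [t [/= pt e]] [u [/= pu e']].
  exists (t * u * g); split=> /=; first by do 2?apply: spec_mulN.
  have -> : t * u * g * (a * h) = u * h * (t * (a * g)) by ring.
  have -> : t * u * g * (c * f) = t * f * (u * (c * g)) by ring.
  by rewrite e -e'; ring.
Qed.

Definition loc : Type := quo frac_equiv.
HB.instance Definition _ := Choice.on loc.

Definition frac (a f : A) (pf : ~ (p : set A) f) : loc :=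
  cls frac_equiv (Prefrac a pf).

Lemma fracP a f (pf : ~ (p : set A) f) b g (pg : ~ (p : set A) g) :
  frac a pf = frac b pg <-> exists t, ~ (p : set A) t /\ t * (a * g) = t * (b * f).
Proof. exact: clsP. Qed.

Lemma locP (x : loc) : exists a f (pf : ~ (p : set A) f), x = frac a pf.
Proof. by rewrite -(repK x); case: (rep x) => a f pf; exists a, f, pf. Qed.

Definition loc_add (x y : loc) : loc :=
  let u := rep x in let v := rep y in
  frac (fnum u * fden v + fnum v * fden u) (spec_mulN (@fdenP u) (@fdenP v)).
Definition loc_mul (x y : loc) : loc :=
  let u := rep x in let v := rep y in
  frac (fnum u * fnum v) (spec_mulN (@fdenP u) (@fdenP v)).
Definition loc_opp (x : loc) : loc :=
  let u := rep x in frac (- fnum u) (@fdenP u).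
Definition loc_zero : loc := frac 0 spec_1N.
Definition loc_one : loc := frac 1 spec_1N.

Lemma loc_addE a f (pf : ~ (p : set A) f) b g (pg : ~ (p : set A) g) :
  loc_add (frac a pf) (frac b pg) = frac (a * g + b * f) (spec_mulN pf pg).
Proof.
rewrite /loc_add {1 2 3}/frac.
have [] := repP frac_equiv (Prefrac a pf).
have [] := repP frac_equiv (Prefrac b pg).
rewrite -!/(frac _ _).
move: (rep (frac a pf)) (rep (frac b pg)) => [a' f' pf'] [b' g' pg'] /=.
move=> t [/= pt e] u [/= pu e']; apply/fracP.
exists (t * u); split; first exact: spec_mulN.
have -> : t * u * ((a' * g' + b' * f') * (f * g))
  = g' * g * t * (u * (a' * f)) + f' * f * u * (t * (b' * g)) by ring.
by rewrite e e'; ring.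
Qed.

Lemma loc_mulE a f (pf : ~ (p : set A) f) b g (pg : ~ (p : set A) g) :
  loc_mul (frac a pf) (frac b pg) = frac (a * b) (spec_mulN pf pg).
Proof.
rewrite /loc_mul {1 2 3}/frac.
have [] := repP frac_equiv (Prefrac a pf).
have [] := repP frac_equiv (Prefrac b pg).
rewrite -!/(frac _ _).
move: (rep (frac a pf)) (rep (frac b pg)) => [a' f' pf'] [b' g' pg'] /=.
move=> t [/= pt e] u [/= pu e']; apply/fracP.
exists (t * u); split; first exact: spec_mulN.
have -> : t * u * (a' * b' * (f * g)) = (u * (a' * f)) * (t * (b' * g)) by ring.
by rewrite e e'; ring.
Qed.

Lemma loc_oppE a f (pf : ~ (p : set A) f) : loc_opp (frac a pf) = frac (- a) pf.
Proof.
rewrite /loc_opp {1 2}/frac.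
have [] := repP frac_equiv (Prefrac a pf).
rewrite -!/(frac _ _).
move: (rep (frac a pf)) => [a' f' pf'] t [/= pt e]; apply/fracP.
by exists t; split=> //; rewrite !mulNr !mulrN e.
Qed.

Lemma frac_eq a f (pf : ~ (p : set A) f) b g (pg : ~ (p : set A) g) :
  a * g = b * f -> frac a pf = frac b pg.
Proof. by move=> e; apply/fracP; exists 1; split; [exact: spec_1N|rewrite e]. Qed.

Lemma loc_addA : associative loc_add.
Proof.
move=> x y z; have [a [f [pf ->]]] := locP x; have [b [g [pg ->]]] := locP y.
have [c [h [ph ->]]] := locP z; rewrite !loc_addE; apply: frac_eq; ring.
Qed.
Lemma loc_addC : commutative loc_add.
Proof.
move=> x y; have [a [f [pf ->]]] := locP x; have [b [g [pg ->]]] := locP y.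
rewrite !loc_addE; apply: frac_eq; ring.
Qed.
Lemma loc_add0 : left_id loc_zero loc_add.
Proof.
move=> x; have [a [f [pf ->]]] := locP x.
rewrite !loc_addE; apply: frac_eq; ring.
Qed.
Lemma loc_addN : left_inverse loc_zero loc_opp loc_add.
Proof.
move=> x; have [a [f [pf ->]]] := locP x.
rewrite loc_oppE !loc_addE; apply: frac_eq; ring.
Qed.
HB.instance Definition _ := GRing.isZmodule.Build loc
  loc_addA loc_addC loc_add0 loc_addN.

Lemma loc_mulA : associative loc_mul.
Proof.
move=> x y z; have [a [f [pf ->]]] := locP x; have [b [g [pg ->]]] := locP y.
have [c [h [ph ->]]] := locP z; rewrite !loc_mulE; apply: frac_eq; ring.
Qed.
Lemma loc_mulC : commutative loc_mul.
Proof.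
move=> x y; have [a [f [pf ->]]] := locP x; have [b [g [pg ->]]] := locP y.
rewrite !loc_mulE; apply: frac_eq; ring.
Qed.
Lemma loc_mul1 : left_id loc_one loc_mul.
Proof.
move=> x; have [a [f [pf ->]]] := locP x.
rewrite !loc_mulE; apply: frac_eq; ring.
Qed.
Lemma loc_mulDl : left_distributive loc_mul loc_add.
Proof.
move=> x y z; have [a [f [pf ->]]] := locP x; have [b [g [pg ->]]] := locP y.
have [c [h [ph ->]]] := locP z.
rewrite !(loc_mulE, loc_addE); apply: frac_eq; ring.
Qed.
HB.instance Definition _ := GRing.Zmodule_isComPzRing.Build loc
  loc_mulA loc_mulC loc_mul1 loc_mulDl.

End Localization.

Section Sections.
Context (U : opens spec).

Definition locally_fraction (s : forall p : spec, oset U p -> loc p) :=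
  forall p : spec, oset U p ->
    exists (V : opens spec) (a f : A), [/\ oset V p, V `<=` U
      & forall (q : spec) (Uq : oset U q), oset V q ->
          exists qf : ~ (q : set A) f, s q Uq = frac a qf].

Record spec_sec := SpecSec {
  sec_val :> forall p : spec, oset U p -> loc p;
  sec_frac : locally_fraction sec_val
}.
HB.instance Definition _ := gen_eqMixin spec_sec.
HB.instance Definition _ := gen_choiceMixin spec_sec.

Lemma spec_sec_eq (s t : spec_sec) : (forall p Up, s p Up = t p Up) -> s = t.
Proof.
case: s t => [s hs] [t ht] /= e.
have est : s = t by apply: functional_extensionality_dep => p; apply: funext.
by subst t; congr SpecSec; exact: Prop_irrelevance.
Qed.

Lemma sec_cst_frac (a : A) :
  locally_fraction (fun p _ => frac a (@spec_1N p)).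
Proof. by move=> p Up; exists U, a, 1; split=> // q Uq _; exists (@spec_1N q). Qed.

Lemma sec_add_frac (s t : spec_sec) :
  locally_fraction (fun p Up => s p Up + t p Up).
Proof.
move=> p Up; have [V [a [f [Vp VU sV]]]] := sec_frac s Up.
have [W [b [g [Wp WU tW]]]] := sec_frac t Up.
exists (opensI V W), (a * g + b * f), (f * g); split=> //.
  by move=> q [/VU].
move=> q Uq [Vq Wq]; have [qf ->] := sV _ Uq Vq; have [qg ->] := tW _ Uq Wq.
by exists (spec_mulN qf qg); apply: loc_addE.
Qed.

Lemma sec_mul_frac (s t : spec_sec) :
  locally_fraction (fun p Up => s p Up * t p Up).
Proof.
move=> p Up; have [V [a [f [Vp VU sV]]]] := sec_frac s Up.
have [W [b [g [Wp WU tW]]]] := sec_frac t Up.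
exists (opensI V W), (a * b), (f * g); split=> //.
  by move=> q [/VU].
move=> q Uq [Vq Wq]; have [qf ->] := sV _ Uq Vq; have [qg ->] := tW _ Uq Wq.
by exists (spec_mulN qf qg); apply: loc_mulE.
Qed.

Lemma sec_opp_frac (s : spec_sec) : locally_fraction (fun p Up => - s p Up).
Proof.
move=> p Up; have [V [a [f [Vp VU sV]]]] := sec_frac s Up.
exists V, (- a), f; split=> // q Uq Vq; have [qf ->] := sV _ Uq Vq.
by exists qf; apply: loc_oppE.
Qed.

Definition sec_add s t := SpecSec (sec_add_frac s t).
Definition sec_mul s t := SpecSec (sec_mul_frac s t).
Definition sec_opp s := SpecSec (sec_opp_frac s).
Definition sec_zero := SpecSec (sec_cst_frac 0).
Definition sec_one := SpecSec (sec_cst_frac 1).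

Lemma sec_addA : associative sec_add.
Proof. by move=> s t u; apply: spec_sec_eq => p Up; apply: addrA. Qed.
Lemma sec_addC : commutative sec_add.
Proof. by move=> s t; apply: spec_sec_eq => p Up; apply: addrC. Qed.
Lemma sec_add0 : left_id sec_zero sec_add.
Proof. by move=> s; apply: spec_sec_eq => p Up; apply: add0r. Qed.
Lemma sec_addN : left_inverse sec_zero sec_opp sec_add.
Proof. by move=> s; apply: spec_sec_eq => p Up; apply: addNr. Qed.
HB.instance Definition _ := GRing.isZmodule.Build spec_sec
  sec_addA sec_addC sec_add0 sec_addN.

Lemma sec_mulA : associative sec_mul.
Proof. by move=> s t u; apply: spec_sec_eq => p Up; apply: mulrA. Qed.
Lemma sec_mulC : commutative sec_mul.
Proof. by move=> s t; apply: spec_sec_eq => p Up; apply: mulrC. Qed.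
Lemma sec_mul1 : left_id sec_one sec_mul.
Proof. by move=> s; apply: spec_sec_eq => p Up; apply: mul1r. Qed.
Lemma sec_mulDl : left_distributive sec_mul sec_add.
Proof. by move=> s t u; apply: spec_sec_eq => p Up; apply: mulrDl. Qed.
HB.instance Definition _ := GRing.Zmodule_isComPzRing.Build spec_sec
  sec_mulA sec_mulC sec_mul1 sec_mulDl.

End Sections.

Section Restriction.
Context (U V : opens spec) (VU : V `<=` U).

Lemma sec_res_frac (s : spec_sec U) :
  @locally_fraction V (fun p Vp => s p (VU Vp)).
Proof.
move=> p Vp; have [W [a [f [Wp WU sW]]]] := sec_frac s (VU Vp).
exists (opensI V W), a, f; split=> //; first exact: opensIl.
by move=> q Vq [_ Wq]; apply: sW.
Qed.

Definition sec_res (s : spec_sec U) : spec_sec V := SpecSec (sec_res_frac s).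

Lemma sec_res_zmod : zmod_morphism sec_res.
Proof. by move=> s t; apply: spec_sec_eq. Qed.
Lemma sec_res_monoid : monoid_morphism sec_res.
Proof. by split=> [|s t]; apply: spec_sec_eq. Qed.
HB.instance Definition _ :=
  GRing.isZmodMorphism.Build (spec_sec U) (spec_sec V) sec_res sec_res_zmod.
HB.instance Definition _ :=
  GRing.isMonoidMorphism.Build (spec_sec U) (spec_sec V) sec_res sec_res_monoid.

End Restriction.

Lemma sec_res_id (U : opens spec) (h : U `<=` U) (s : spec_sec U) :
  sec_res h s = s.
Proof.
by apply: spec_sec_eq => p Up /=; congr (sec_val s _); exact: Prop_irrelevance.
Qed.

Lemma sec_res_comp (U V W : opens spec) (h : V `<=` U) (h' : W `<=` V)
  (h'' : W `<=` U) (s : spec_sec U) : sec_res h' (sec_res h s) = sec_res h'' s.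
Proof.
by apply: spec_sec_eq => p Up /=; congr (sec_val s _); exact: Prop_irrelevance.
Qed.

Lemma spec_sheaf : is_sheaf (Presheaf sec_res_id sec_res_comp).
Proof.
move=> U I V VU cov s comp.
have agree i j (p : spec) (Vi : oset (V i) p) (Vj : oset (V j) p) :
    s i p Vi = s j p Vj.
  have /(congr1 (fun t : spec_sec (opensI (V i) (V j)) => t p (conj Vi Vj))) /= := comp i j.
  by rewrite (Prop_irrelevance (opensIl _) Vi) (Prop_irrelevance (opensIr _) Vj).
have ex p (Up : oset U p) : exists i, oset (V i) p.
  by have [i _ Vp] := cov p Up; exists i.
pose v p (Up : oset U p) : loc p := s _ p (projT2 (cid (ex p Up))).
have vE i p (Up : oset U p) (Vp : oset (V i) p) : v p Up = s i p Vp by exact: agree.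
have vfrac : @locally_fraction U v.
  move=> p Up; have [i Vp] := ex p Up.
  have [W [a [f [Wp WV sW]]]] := sec_frac (s i) Vp.
  exists W, a, f; split=> //; first exact: subset_trans WV (VU i).
  move=> q Uq Wq; rewrite (vE i q Uq (WV _ Wq)); exact: sW.
exists (SpecSec vfrac); split=> [i|t tE].
  by apply: spec_sec_eq => p Vp /=; exact: vE.
apply: spec_sec_eq => p Up /=; have [i Vp] := ex p Up.
rewrite (vE i p Up Vp) -(tE i) /=; congr (sec_val t _); exact: Prop_irrelevance.
Qed.

Definition Spec_rs : ringedSpace :=
  @RingedSpace spec spec_sec sec_res sec_res_id sec_res_comp spec_sheaf.

End Spec.

Definition affine_iso (X : ringedSpace) (U : opens X) (A : comPzRingType) :=
  exists f : rsMorphism (restrict U) (Spec_rs A), is_iso f.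

Definition affine_open (X : ringedSpace) (U : opens X) :=
  exists A : comPzRingType, affine_iso U A.

(* The stalks are automatically local, being localizations at primes. *)
Record scheme := Scheme {
  scheme_rs :> ringedSpace;
  scheme_affine : forall x : scheme_rs,
    exists U : opens scheme_rs, oset U x /\ affine_open U
}.

(* A homomorphism of local rings is local when it reflects units. *)
Record schemeMorphism (X Y : scheme) := SchemeMorphism {
  sm_mor :> rsMorphism X Y;
  sm_local : forall (x : X) (a : ostalk (sm_mor x)),
    is_unit (stalk_map sm_mor x a) -> is_unit a
}.

Definition reduced (X : scheme) :=
  forall (U : opens X) (s : 'O U) (n : nat), s ^+ n = 0 -> s = 0.

Definition noetherian_scheme (X : scheme) :=
  exists (n : nat) (U : 'I_n -> opens X),
    (forall x : X, exists i, oset (U i) x) /\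
    forall i, exists A : comPzRingType, noetherian_ring A /\ affine_iso (U i) A.

Definition finite_type (X Y : scheme) (f : schemeMorphism X Y) :=
  exists (I : Type) (V : I -> opens Y),
    [/\ forall y : Y, exists i, oset (V i) y,
        forall i, affine_open (V i)
      & forall i, exists (n : nat) (U : 'I_n -> opens X),
          [/\ forall x : X, oset (V i) (f x) <-> exists j, oset (U j) x,
              forall j, affine_open (U j)
            & forall j, exists UV : U j `<=` rm_preim f (V i),
                finite_type_ring (rs_res UV \o rm_sharp f (V i))]].

Section Coherent.
Context (X : ringedSpace) (F : omodule X).

Definition om_finite_type :=
  forall x : X, exists (U : opens X) (n : nat) (s : 'I_n -> F U),
    oset U x /\ forall (y : X) (Uy : oset U y) (g : mstalk F y),
      exists c : 'I_n -> ostalk y, g = \sum_(i < n) c i *: mgerm Uy (s i).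

(* The kernel of the morphism O_U^n -> F|_U given by s_1, ..., s_n in F(U) is
   of finite type: near each x it has finitely many sections k_1, ..., k_m
   (over some V) which generate all its stalks.  The stalk of the kernel at y
   is the module of relations between the germs of the s_i at y. *)
Definition relations_finite_type (U : opens X) (n : nat) (s : 'I_n -> F U) :=
  forall x : X, oset U x ->
    exists (V : opens X) (VU : V `<=` U) (m : nat) (k : 'I_m -> 'I_n -> 'O V),
      [/\ oset V x,
          forall j, \sum_(i < n) k j i *: om_res F VU (s i) = 0
        & forall (y : X) (Vy : oset V y) (c : 'I_n -> ostalk y),
            \sum_(i < n) c i *: mgerm (VU _ Vy) (s i) = 0 ->
            exists d : 'I_m -> ostalk y,
              forall i, c i = \sum_(j < m) d j * ogerm Vy (k j i)].

Definition coherent :=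
  om_finite_type /\
  forall (U : opens X) (n : nat) (s : 'I_n -> F U), relations_finite_type s.

End Coherent.

(* Main.v *)
(* Choose an affine open V of Y and finitely many affine opens U_j covering its
   preimage; write A = O(V), B = O(U_j).  Near each point of U_j the sheaf F is
   presented by finitely many generators and relations, and clearing
   denominators gives a submodule N of B^n such that the stalks of F near that
   point are localizations of B^n / N.  As an A-module, B^n is spanned by the
   monomials x^a e_i in the A-algebra generators x of B.  For g <> 0 in A call a
   monomial leading over A[1/g] if, modulo N, some g^k times it is a combination
   of smaller monomials.  By Dickson's lemma there is a multiple g <> 0 of any
   prescribed nonzero element for which the set of leading monomials is maximal;
   since A is reduced, the other monomials are then a basis of (B^n / N)[1/g]
   over A[1/g].  So F is flat at the points where g is invertible, and g can be
   adjusted successively to finitely many neighbourhoods, U_j being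
   quasi-compact.  Flatness is obtained from the equational criterion, which
   passes directly from a free module to its localizations. *)
From HB Require Import structures.
Require Import Defs.
From mathcomp Require Import all_boot all_algebra.
From mathcomp Require Import boolp classical_sets functions topology.
From mathcomp Require Import ring zify.

Set Implicit Arguments.
Unset Strict Implicit.
Unset Printing Implicit Defensive.

Import GRing.Theory.
Local Open Scope classical_set_scope.
Local Open Scope ring_scope.

(** * The equational criterion for flatness *)

(** Finitely many relations are trivialised at once by one family [n]. The index types are arbitrary
    finite types, so that two families can be joined along a sum type. *)
Definition equational (R : comPzRingType) (M : lmodType R) :=
  forall (J L : finType) (m : J -> M) (r : L -> J -> R),
    (forall l, \sum_j r l j *: m j = 0) ->
    exists (K : finType) (n : K -> M) (a : J -> K -> R),
      (forall j, m j = \sum_k a j k *: n k) /\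
      forall l k, \sum_j r l j * a j k = 0.

Section EquationalFlat.
Context (R : comPzRingType).

Section Decorated.
Context (N M : lmodType R).

(* The list w stands for the sum of the n (x) (sum_k c k *: m k) over the (n, c)
   in w; expanding it along the m k gives the coefficients tcoef w k. *)
Definition tlist (K : finType) (m : K -> M) (w : seq (N * (K -> R))) :
  seq (N * M) := [seq (p.1, \sum_k p.2 k *: m k) | p <- w].

Definition tcoef (K : finType) (w : seq (N * (K -> R))) (k : K) : N :=
  \sum_(p <- w) p.2 k *: p.1.

(** A testable substitute for the inductive relation [tensor_rel]: both lists are expanded along one
    family [m] and the coefficients in [N] are compared. Among its closure properties, only
    transitivity calls on the equational criterion. *)
Definition tensor_eqv (s t : seq (N * M)) :=
  exists (K : finType) (m : K -> M) (w v : seq (N * (K -> R))),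
    [/\ s = tlist m w, t = tlist m v & forall k, tcoef w k = tcoef v k].

Lemma tensor_eqv_sym s t : tensor_eqv s t -> tensor_eqv t s.
Proof. by move=> [K [m [w [v [-> -> e]]]]]; exists K, m, v, w; split=> // k. Qed.

Lemma tlist_cat (K : finType) (m : K -> M) w v :
  tlist m (w ++ v) = tlist m w ++ tlist m v.
Proof. by rewrite /tlist map_cat. Qed.

Lemma tcoef_cat (K : finType) (w v : seq (N * (K -> R))) k :
  tcoef (w ++ v) k = tcoef w k + tcoef v k.
Proof. by rewrite /tcoef big_cat. Qed.

(** The substitution of [m = a m'] into combinations of the [m k], carried out on coefficients. *)
Definition reindex (K K' : finType) (a : K -> K' -> R)
  (w : seq (N * (K -> R))) : seq (N * (K' -> R)) :=
  [seq (p.1, fun k' => \sum_k p.2 k * a k k') | p <- w].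

Lemma tlist_reindex (K K' : finType) (a : K -> K' -> R) (m : K -> M)
    (m' : K' -> M) w :
  (forall k, m k = \sum_k' a k k' *: m' k') ->
  tlist m' (reindex a w) = tlist m w.
Proof.
move=> mE; rewrite /tlist /reindex -map_comp; apply: eq_map => -[n c] /=.
congr (_, _); under [RHS]eq_bigr => k _ do rewrite mE scaler_sumr.
rewrite [RHS]exchange_big /=; apply: eq_bigr => k' _.
by rewrite scaler_suml; apply: eq_bigr => k _; rewrite scalerA.
Qed.

Lemma tcoef_reindex (K K' : finType) (a : K -> K' -> R)
    (w : seq (N * (K -> R))) k' :
  tcoef (reindex a w) k' = \sum_k a k k' *: tcoef w k.
Proof.
rewrite /tcoef /reindex big_map /=.
under [RHS]eq_bigr => k _ do rewrite scaler_sumr.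
rewrite [RHS]exchange_big /=; apply: eq_bigr => p _.
by rewrite scaler_suml; apply: eq_bigr => k _; rewrite scalerA mulrC.
Qed.

Definition inl_coef (K K' : finType) (k : K) (z : K + K') : R :=
  if z is inl k' then (k == k')%:R else 0.
Definition inr_coef (K K' : finType) (k : K') (z : K + K') : R :=
  if z is inr k' then (k == k')%:R else 0.

Lemma sum_delta (K : finType) (f : K -> M) k :
  \sum_k' (k == k')%:R *: f k' = f k.
Proof.
rewrite (bigD1 k) //= eqxx scale1r big1 ?addr0 // => k' ne.
by rewrite eq_sym (negbTE ne) scale0r.
Qed.

Lemma inl_coefE (K K' : finType) (m : K + K' -> M) (k : K) :
  m (inl k) = \sum_z inl_coef k z *: m z.
Proof.
rewrite big_sumType /= (sum_delta (fun k => m (inl k))).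
by rewrite big1 ?addr0 // => i _; rewrite scale0r.
Qed.

Lemma inr_coefE (K K' : finType) (m : K + K' -> M) (k : K') :
  m (inr k) = \sum_z inr_coef k z *: m z.
Proof.
rewrite big_sumType /= (sum_delta (fun k => m (inr k))).
by rewrite big1 ?add0r // => i _; rewrite scale0r.
Qed.

Lemma tensor_eqv_cat s s' t t' :
  tensor_eqv s s' -> tensor_eqv t t' -> tensor_eqv (s ++ t) (s' ++ t').
Proof.
move=> [K [m [w [v [-> -> e]]]]] [K' [m' [w' [v' [-> -> e']]]]].
pose mm (z : K + K') := match z with inl k => m k | inr k => m' k end.
pose a := @inl_coef K K'; pose b := @inr_coef K K'.
have ma k : m k = \sum_z a k z *: mm z by exact: (inl_coefE mm k).
have mb k : m' k = \sum_z b k z *: mm z by exact: (inr_coefE mm k).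
exists (K + K')%type, mm, (reindex a w ++ reindex b w'),
  (reindex a v ++ reindex b v'); split.
- by rewrite tlist_cat (tlist_reindex _ ma) (tlist_reindex _ mb).
- by rewrite tlist_cat (tlist_reindex _ ma) (tlist_reindex _ mb).
- move=> k; rewrite !tcoef_cat !tcoef_reindex.
  by congr (_ + _); apply: eq_bigr => j _; rewrite ?e ?e'.
Qed.

(** A one-element family handles the generating relations whose second factors are all multiples of
    a single vector. *)
Lemma tensor_eqv1 n (m : M) c w :
  c *: n = tcoef w tt ->
  tensor_eqv [:: (n, c *: m)] (tlist (fun _ : unit => m) w).
Proof.
move=> e; exists unit, (fun=> m), [:: (n, fun=> c)], w; split=> //.
  by rewrite /tlist /= big_const card_unit /= addr0.
by case; rewrite -e /tcoef big_seq1.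
Qed.

Lemma tensor_eqv_refl s : tensor_eqv s s.
Proof.
elim: s => [|[n m] s ih].
  exists void, (@of_void _), [::], [::]; split=> //.
suff h : tensor_eqv [:: (n, m)] [:: (n, m)] by exact: tensor_eqv_cat h ih.
exists unit, (fun=> m), [:: (n, fun=> 1)], [:: (n, fun=> 1)]; split=> //;
  by rewrite /tlist /= big_const card_unit /= addr0 scale1r.
Qed.

Lemma tensor_eqv_comm s t : tensor_eqv (s ++ t) (t ++ s).
Proof.
have [K [m [w [v [es et e]]]]] := tensor_eqv_refl (s ++ t).
(* The decoration of [s ++ t] given by reflexivity is cut at the length of [s]. *)
pose w1 := take (size s) w; pose w2 := drop (size s) w.
have e1 : s = tlist m w1 by rewrite /tlist map_take -[map _ _]es take_size_cat.
have e2 : t = tlist m w2 by rewrite /tlist map_drop -[map _ _]es drop_size_cat.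
exists K, m, (w1 ++ w2), (w2 ++ w1); split=> [||k].
- by rewrite tlist_cat -e1 -e2.
- by rewrite tlist_cat -e1 -e2.
- by rewrite !tcoef_cat addrC.
Qed.

(** The middle list has expansions along both [m] and [m']. Entry by entry their difference is a
    relation in the joint family [mm]. The criterion factors [mm] through a family [n] along which
    the two expansions become the same decorated list. *)
Lemma tensor_eqv_trans s t u : equational M ->
  tensor_eqv s t -> tensor_eqv t u -> tensor_eqv s u.
Proof.
move=> Meq [K [m [w [v [-> -> e]]]]] [K' [m' [w' [v' [e1 -> e']]]]].
pose mm (z : K + K') := match z with inl k => m k | inr k => m' k end.
have sz : size v = size w' by move/(congr1 size): e1; rewrite !size_map.
pose d : N * (K -> R) := (0, fun=> 0); pose d' : N * (K' -> R) := (0, fun=> 0).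
pose r (i : 'I_(size v)) (z : K + K') : R :=
  match z with inl k => (nth d v i).2 k | inr k => - (nth d' w' i).2 k end.
have nthE (i : 'I_(size v)) : (nth d v i).1 = (nth d' w' i).1 /\
    \sum_k (nth d v i).2 k *: m k = \sum_k (nth d' w' i).2 k *: m' k.
  move/(congr1 (fun x => nth (0, 0) x i)): e1.
  by rewrite !(nth_map d) ?(nth_map d') -?sz // => -[].
have [i|K3 [n [a [mmE aE]]]] := Meq _ _ mm r.
  rewrite big_sumType /=; under [X in _ + X]eq_bigr => k _ do rewrite scaleNr.
  by rewrite sumrN (nthE i).2 subrr.
pose a1 k := a (inl k); pose a2 k := a (inr k).
have ma k : m k = \sum_z a1 k z *: n z by exact: (mmE (inl k)).
have mb k : m' k = \sum_z a2 k z *: n z by exact: (mmE (inr k)).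
have vw : reindex a1 v = reindex a2 w'.
  apply: (@eq_from_nth _ (0, fun=> 0)) => [|i]; rewrite !size_map // => iv.
  rewrite !(nth_map d) ?(nth_map d') -?sz //=.
  have [/= -> _] := nthE (Ordinal iv); congr (_, _); apply/funext => k.
  have := aE (Ordinal iv) k; rewrite big_sumType /=.
  under [X in _ + X]eq_bigr => j _ do rewrite mulNr.
  by rewrite sumrN => /subr0_eq.
exists K3, n, (reindex a1 w), (reindex a2 v'); split=> [||k].
- by rewrite (tlist_reindex _ ma).
- by rewrite (tlist_reindex _ mb).
- rewrite tcoef_reindex; under eq_bigr => j _ do rewrite e.
  rewrite -tcoef_reindex vw !tcoef_reindex.
  by apply: eq_bigr => j _; rewrite e'.
Qed.

Lemma tensor_rel_eqv s t : equational M -> tensor_rel s t -> tensor_eqv s t.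
Proof.
move=> Meq; elim=> {s t}.
- exact: tensor_eqv_refl.
- by move=> s t _; apply: tensor_eqv_sym.
- by move=> s t u _ st _; apply: tensor_eqv_trans.
- by move=> s s' t t' _ ss' _; apply: tensor_eqv_cat.
- exact: tensor_eqv_comm.
- move=> n; have h := @tensor_eqv1 0 n 1 [::]; move: h; rewrite !scale1r.
  by apply; rewrite /tcoef big_nil.
- move=> m m' n; have := @tensor_eqv1 (m + m') n 1 [:: (m, fun=> 1); (m', fun=> 1)].
  rewrite /tlist /tcoef /= !big_const card_unit /= !addr0 !scale1r; apply.
  by rewrite big_cons big_seq1 /= !scale1r.
(* Additivity in the second factor involves two vectors, so the family is indexed by [bool]. *)
- move=> m n n'; pose mm b : M := if b then n else n'.
  exists bool, mm, [:: (m, fun=> 1)],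
    [:: (m, fun b : bool => b%:R); (m, fun b : bool => (~~ b)%:R)]; split=> [||b].
  + by rewrite /tlist /= big_bool /= !scale1r.
  + by rewrite /tlist /= !big_bool /= !scale1r !scale0r addr0 add0r.
  + rewrite /tcoef big_seq1 big_cons big_seq1 /=.
    by case: b; rewrite scale1r scale0r ?addr0 ?add0r.
- move=> r m n; have := @tensor_eqv1 (r *: m) n 1 [:: (m, fun=> r)].
  rewrite /tlist /tcoef /= !big_const card_unit /= !addr0 !scale1r; apply.
  by rewrite big_seq1.
Qed.

(** A normal form: second components are expanded by bilinearity and the terms with the same [m k]
    are merged. Hence the class of a list depends only on [tcoef]. *)
Lemma tensor_rel_tlist (K : finType) (m : K -> M) w :
  tensor_rel (tlist m w) [seq (tcoef w k, m k) | k <- enum K].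
Proof.
(* The generators only kill a zero in the first factor, so the scalar [0] is moved across. *)
have zero (n : N) : tensor_rel [:: (n, 0 : M)] [::].
  apply: (tensor_trans (t := [:: (0 *: n, 0 : M)])); last first.
    by rewrite scale0r; exact: tensor_zero.
  have := tensor_scale 0 n (0 : M); rewrite scaler0; exact: tensor_sym.
have sum (I : Type) (r : seq I) (n : N) (c : I -> R) (x : I -> M) :
    tensor_rel [:: (n, \sum_(i <- r) c i *: x i)] [seq (c i *: n, x i) | i <- r].
  elim: r => [|i r ih]; first by rewrite big_nil; exact: zero.
  rewrite big_cons /=; apply: tensor_trans (tensor_addr _ _ _) _.
  rewrite -cat1s -[X in tensor_rel _ X]cat1s; apply: tensor_cat ih.
  by apply: tensor_sym; exact: tensor_scale.
have merge (I : Type) (r : seq I) (f g : I -> N) (x : I -> M) :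
    tensor_rel ([seq (f i, x i) | i <- r] ++ [seq (g i, x i) | i <- r])
      [seq (f i + g i, x i) | i <- r].
  elim: r => [|i r ih] /=; first exact: tensor_refl.
  set s1 := map _ r in ih *; set s2 := map _ r in ih *.
  apply: (tensor_trans (t := [:: (f i, x i); (g i, x i)] ++ (s1 ++ s2))).
    rewrite /= -[(f i, x i) :: (s1 ++ _)]cat1s -[_ :: _ :: _]cat1s.
    apply: tensor_cat; first exact: tensor_refl.
    rewrite -cat1s -[X in tensor_rel _ X]cat1s !catA.
    by apply: tensor_cat; [exact: tensor_comm|exact: tensor_refl].
  rewrite -[X in tensor_rel _ X]cat1s; apply: tensor_cat ih.
  by apply: tensor_sym; exact: tensor_addl.
elim: w => [|[n c] w ih].
  rewrite /=; elim: (enum K) => [|k r ih] /=; first exact: tensor_refl.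
  rewrite /tcoef big_nil -cat1s -[X in tensor_rel X _]cat0s.
  by apply: tensor_cat ih; apply: tensor_sym; exact: tensor_zero.
rewrite -cat1s tlist_cat.
apply: (tensor_trans (t := [seq (c k *: n, m k) | k <- enum K] ++
    [seq (tcoef w k, m k) | k <- enum K])).
  by apply: tensor_cat ih; have := sum K (enum K) n c m; rewrite big_enum.
apply: tensor_trans (merge _ _ _ _ _) _; rewrite cat1s.
have -> : [seq (tcoef ((n, c) :: w) k, m k) | k <- enum K]
  = [seq (c k *: n + tcoef w k, m k) | k <- enum K].
  by apply: eq_map => k; rewrite /tcoef big_cons.
exact: tensor_refl.
Qed.

End Decorated.

(** Equality of the images yields decorations over [N']. Their first components lie in the image of
    [f], so they lift to decorations over [N]. By injectivity the coefficients already agree in [N],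
    and the normal form concludes. *)
Lemma flat_of_equational (M : lmodType R) : equational M -> flat M.
Proof.
move=> Meq N N' f finj z z'; rewrite -(repK z) -(repK z') !tensor_mapE.
move: (rep z) (rep z') => s t /clsP /(tensor_rel_eqv Meq) [K [m [w [v [sE tE e]]]]].
have split (r : seq (N * M)) (u : seq (N' * (K -> R))) :
    [seq (f u.1, u.2) | u <- r] = tlist m u ->
    exists2 u' : seq (N * (K -> R)), r = tlist m u' &
      u = [seq (f p.1, p.2) | p <- u'].
  elim: r u => [|[n x] r ih] [|[n' c] u] //=; first by exists [::].
  move=> [<- -> /ih [u' -> ->]]; by exists ((n, c) :: u').
have [w' -> wE] := split _ _ sE; have [v' -> vE] := split _ _ tE.
have fE (u : seq (N * (K -> R))) k :
    tcoef [seq (f p.1, p.2) | p <- u] k = f (tcoef u k).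
  by rewrite /tcoef big_map linear_sum; apply: eq_bigr => p _; rewrite linearZ_LR.
have wv k : tcoef w' k = tcoef v' k by apply: finj; rewrite -!fE -wE -vE e.
apply/clsP; apply: tensor_trans (tensor_rel_tlist _ _) _.
under eq_map => k do rewrite wv.
by apply: tensor_sym; exact: tensor_rel_tlist.
Qed.

End EquationalFlat.

(** * Monomials and Dickson's lemma *)

(** Greedy choice, each index being taken beyond the preceding one. [P] may depend on the bound [N],
    so it can speak of the whole tail from [N] on. *)
Lemma infinite_subsequence (P : nat -> nat -> Prop) :
  (forall N, exists2 k, (N <= k)%N & P N k) ->
  exists phi : nat -> nat, {homo phi : i j / (i < j)%N} /\
    forall i, exists2 N, (N <= phi i)%N & (forall j, (j < i)%N -> (phi j < N)%N) /\ P N (phi i).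
Proof.
move=> h; have /choice[f fP] : forall N, exists k, (N <= k)%N /\ P N k.
  by move=> N; have [k] := h N; exists k.
pose phi := fix phi i := if i is j.+1 then f (phi j).+1 else f 0%N.
have phiS i : (phi i < phi i.+1)%N by case: (fP (phi i).+1).
have mono : {homo phi : i j / (i < j)%N} by exact: homo_ltn ltn_trans phiS.
exists phi; split=> // -[|i].
  by exists 0%N => //; split=> //; case: (fP 0%N).
exists (phi i).+1 => //; split; last by case: (fP (phi i).+1).
by move=> j; rewrite ltnS leq_eqVlt ltnS => /orP[/eqP->|/mono /ltnW].
Qed.

(** The next index is a place where [s] attains its minimum over the remaining tail. *)
Lemma nat_nondecreasing_subsequence (s : nat -> nat) :
  exists phi : nat -> nat, {homo phi : i j / (i < j)%N} /\
    forall i j, (i < j)%N -> (s (phi i) <= s (phi j))%N.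
Proof.
have min N : exists2 k, (N <= k)%N & forall l, (N <= l)%N -> (s k <= s l)%N.
  have ex : exists v, `[< exists2 k, (N <= k)%N & s k = v >].
    by exists (s N); apply/asboolP; exists N.
  case: (ex_minnP ex) => v /asboolP[k Nk <-] vmin; exists k => // l Nl.
  by apply: vmin; apply/asboolP; exists l.
have [phi [mono phiP]] := infinite_subsequence min.
exists phi; split=> // i j ij; have [N Ni [_ ]] := phiP i; apply.
by apply: leq_trans Ni _; apply: ltnW; exact: mono.
Qed.

(** Pigeonhole: if each value [c] stopped occurring from [f c] on, the value of [s] at the largest
    [f c] would be impossible. *)
Lemma ord_constant_subsequence m (s : nat -> 'I_m) :
  exists phi : nat -> nat, {homo phi : i j / (i < j)%N} /\
    forall i j, s (phi i) = s (phi j).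
Proof.
have [c cP] : exists c, forall N, exists2 k, (N <= k)%N & s k = c.
  apply: contrapT => /forallNP h.
  have /choice[f fP] : forall c, exists N, forall k, (N <= k)%N -> s k <> c.
    move=> c; have /existsNP[N hN] := h c.
    by exists N => k Nk e; apply: hN; exists k.
  by apply: (fP (s (\max_c f c)) _ _ erefl); exact: leq_bigmax.
have [phi [mono phiP]] := infinite_subsequence cP.
exists phi; split=> // i j.
by have [_ _ [_ ->]] := phiP i; have [_ _ [_ ->]] := phiP j.
Qed.

(* mon is the set of monomials x^a e_i in the variables x of G, and mval gives
   their values in M.  The interface is abstract so that the variables can be
   adjoined one at a time. *)
Record monomials (B : comPzRingType) (M : lmodType B) (G : set B) := Monomials {
  mon :> choiceType;
  mlt : mon -> mon -> Prop;
  mdv : mon -> mon -> Prop;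
  mval : mon -> M;
  mlt_wf : well_founded mlt;
  mlt_trans : forall x y z, mlt x y -> mlt y z -> mlt x z;
  mlt_total : forall x y, [\/ mlt x y, x = y | mlt y x];
  mdvP : forall x y, mdv x y -> exists b, mval y = b *: mval x /\
    forall x', mlt x' x -> exists y', mlt y' y /\ mval y' = b *: mval x';
  dickson : forall s : nat -> mon, exists phi : nat -> nat,
    {homo phi : i j / (i < j)%N} /\
    forall i j, (i < j)%N -> mdv (s (phi i)) (s (phi j));
  mshift : forall b x, G b -> exists y, mval y = b *: mval x
}.

Section MonomialsExist.
Context (B : comPzRingType) (M : lmodType B).

(** Without variables the monomials are indexed by the [eps i], ordered by index and dividing only
    themselves. *)
Lemma monomials0 m (eps : 'I_m -> M) :
  exists T : monomials M set0, forall i, exists x : T, mval x = eps i.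
Proof.
have wf : well_founded (fun i j : 'I_m => (i < j)%N).
  move=> i; have [n] := ubnP (i : nat); elim: n i => [//|n ih i].
  by rewrite ltnS => lin; constructor=> j ji; apply: ih; exact: leq_trans ji lin.
unshelve eexists (@Monomials B M set0 'I_m (fun i j => (i < j)%N)
  (fun i j => i = j) eps wf _ _ _ _ _).
- by move=> x y z; exact: ltn_trans.
- move=> x y; case: (ltngtP x y) => [||/val_inj].
  + by constructor 1.
  + by constructor 3.
  + by constructor 2.
- move=> x _ <-; exists 1; rewrite scale1r; split=> // x' lt.
  by exists x'; rewrite scale1r.
- move=> s; have [phi [mono phiP]] := ord_constant_subsequence s.
  by exists phi.
- by [].
- by move=> i; exists i.
Qed.

(** The pair [(a, x)] stands for [g ^+ a] times [x]. The order is lexicographic with [x] compared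
    first, and divisibility is componentwise. Dickson's property follows by making the exponents
    nondecreasing and then extracting again in [T]. *)
Lemma monomialsS (G : set B) (g : B) (T : monomials M G) :
  exists T' : monomials M (g |` G), forall x : T, exists x' : T',
    mval x' = mval x.
Proof.
pose lt (x y : nat * T) := mlt x.2 y.2 \/ x.2 = y.2 /\ (x.1 < y.1)%N.
have wf : well_founded lt.
  move=> [a x]; elim/(well_founded_ind (@mlt_wf _ _ _ T)): x a => x ihx a.
  have [n] := ubnP a; elim: n a => [//|n ih a]; rewrite ltnS => an.
  constructor=> -[b y] [/= /ihx yx //|/= [-> ba]].
  by apply: ih; exact: leq_trans ba an.
unshelve eexists (@Monomials B M (g |` G) (nat * T)%type lt
  (fun x y => (x.1 <= y.1)%N /\ mdv x.2 y.2)
  (fun x => g ^+ x.1 *: mval x.2) wf _ _ _ _ _).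
- move=> [a x] [b y] [c z]; rewrite /lt /= => -[xy|[-> ab]] [yz|[<- bc]].
  + by left; exact: mlt_trans yz.
  + by left.
  + by left.
  + by right; split=> //; exact: ltn_trans bc.
- move=> [a x] [b y]; rewrite /lt /=; case: (mlt_total x y) => [||].
  + by constructor 1; left.
  + move=> ->; case: (ltngtP a b) => [||->].
    * by constructor 1; right.
    * by constructor 3; right.
    * by constructor 2.
  + by constructor 3; left.
- move=> [a x] [b y] /= [ab /mdvP[c [yE lower]]].
  exists (g ^+ (b - a) * c); split.
    by rewrite yE !scalerA mulrAC -exprD subnK.
  (* A smaller monomial is smaller in [T], or has the same part in [T] and a smaller exponent. *)
  move=> [a' x'] [/= /lower[y' [y'y e]]|/= [-> a'a]].
    exists ((b - a + a')%N, y'); split; first by left.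
    by rewrite /= e !scalerA mulrAC -exprD.
  exists ((b - a + a')%N, y); split; first by right; split=> //=; lia.
  by rewrite /= yE !scalerA mulrAC -exprD.
- move=> s.
  have [phi [phimono phiP]] := nat_nondecreasing_subsequence (fun i => (s i).1).
  have [psi [psimono psiP]] := dickson (fun i => (s (phi i)).2).
  exists (phi \o psi); split=> [i j ij|i j ij] /=; first by apply/phimono/psimono.
  by split; [apply/phiP/psimono|exact: psiP].
- move=> b [a x] [->|Gb].
    by exists (a.+1, x); rewrite scalerA -exprS.
  have [y e] := mshift x Gb; exists (a, y).
  by rewrite /= e !scalerA mulrC.
- by move=> x; exists (0%N, x); rewrite /= scale1r.
Qed.

Lemma monomials_exist m (eps : 'I_m -> M) n (g : 'I_n -> B) :
  exists T : monomials M (range g), forall i, exists x : T, mval x = eps i.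
Proof.
elim: n g => [|n ih] g.
  suff -> : range g = set0 by exact: monomials0.
  by apply/seteqP; split=> // y [[]].
have [T Teps] := ih (fun i => g (lift ord0 i)).
suff -> : range g = g ord0 |` range (fun i => g (lift ord0 i)).
  have [T' T'P] := monomialsS (g ord0) T; exists T' => i.
  by have [x <-] := Teps i; exact: T'P.
apply/seteqP; split=> [_ [i _ <-]|_ [->|[i _ <-]]].
- by case: (unliftP ord0 i) => [j ->|->]; [right; exists j|left].
- by exists ord0.
- by exists (lift ord0 i).
Qed.

End MonomialsExist.

(** * Leading monomials *)

Section LeadingTerms.
Context (A B : comPzRingType) (iota : {rmorphism A -> B}) (M : lmodType B).
Context (N : set M) (G : set B) (T : monomials M G).
Hypothesis N0 : N 0.
Hypothesis ND : forall u v, N u -> N v -> N (u + v).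
Hypothesis NZ : forall b u, N u -> N (b *: u).

Definition comb (s : seq T) (a : T -> A) : M :=
  \sum_(x <- s) iota (a x) *: mval x.

(** Padding with zero coefficients brings several combinations to a common support. *)
Lemma comb_extend (s s' : seq T) a : uniq s -> uniq s' -> {subset s <= s'} ->
  comb s a = comb s' (fun x => if x \in s then a x else 0).
Proof.
move=> us us' ss'; rewrite /comb.
under [RHS]eq_bigr => x _ do rewrite fun_if rmorph0 (fun_if (fun b => b *: _)) scale0r.
rewrite -big_mkcond -big_filter; apply: perm_big.
apply: uniq_perm; rewrite ?filter_uniq // => x.
by rewrite mem_filter; case xs: (x \in s) => //=; rewrite ss'.
Qed.

Lemma comb_lin (I : Type) (r : seq I) (s : seq T) (b : I -> A) (c : I -> T -> A) :
  comb s (fun x => \sum_(i <- r) b i * c i x)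
  = \sum_(i <- r) iota (b i) *: comb s (c i).
Proof.
rewrite /comb; under [RHS]eq_bigr => i _ do rewrite scaler_sumr.
rewrite [RHS]exchange_big /=; apply: eq_bigr => x _.
rewrite rmorph_sum scaler_suml; apply: eq_bigr => i _.
by rewrite rmorphM scalerA.
Qed.

Definition in_span (P : T -> Prop) (v : M) :=
  exists (s : seq T) (a : T -> A),
    [/\ uniq s, forall x, x \in s -> P x & N (v - comb s a)].

Lemma submod_opp u : N u -> N (- u).
Proof. by move=> Nu; rewrite -scaleN1r; apply: NZ. Qed.

Lemma submod_sub u v : N u -> N v -> N (u - v).
Proof. by move=> Nu Nv; apply: ND Nu _; apply: submod_opp. Qed.

Lemma in_span_mod P u v : N (u - v) -> in_span P v -> in_span P u.
Proof.
move=> Nuv [s [a [us sP Nv]]]; exists s, a; split=> //.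
by have := ND Nuv Nv; rewrite addrA subrK.
Qed.

Lemma in_span0 P : in_span P 0.
Proof. by exists [::], (fun=> 0); split; rewrite // /comb big_nil subr0. Qed.

Lemma in_spanD P u v : in_span P u -> in_span P v -> in_span P (u + v).
Proof.
move=> [s [a [us sP Nu]]] [t [b [ut tP Nv]]].
pose s' := undup (s ++ t).
have us' : uniq s' by exact: undup_uniq.
have ss' : {subset s <= s'} by move=> x xs; rewrite mem_undup mem_cat xs.
have ts' : {subset t <= s'} by move=> x xt; rewrite mem_undup mem_cat xt orbT.
rewrite (comb_extend a us us' ss') in Nu; rewrite (comb_extend b ut us' ts') in Nv.
move: Nu Nv; set a' := (X in comb s' X); move=> Nu; set b' := (X in comb s' X) => Nv.
exists s', (fun x => a' x + b' x); split=> //.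
  by move=> x; rewrite mem_undup mem_cat => /orP[/sP|/tP].
have -> : comb s' (fun x => a' x + b' x) = comb s' a' + comb s' b'.
  by rewrite -big_split; apply: eq_bigr => x _; rewrite rmorphD scalerDl.
by rewrite opprD addrACA; apply: ND.
Qed.

Lemma in_spanZ P a v : in_span P v -> in_span P (iota a *: v).
Proof.
move=> [s [c [us sP Nv]]]; exists s, (fun x => a * c x); split=> //.
have -> : comb s (fun x => a * c x) = iota a *: comb s c.
  by rewrite scaler_sumr; apply: eq_bigr => x _; rewrite rmorphM scalerA.
by rewrite -scalerBr; apply: NZ.
Qed.

Lemma in_span_mval (P : T -> Prop) x : P x -> in_span P (mval x).
Proof.
move=> Px; exists [:: x], (fun=> 1); split=> //.
  by move=> y; rewrite inE => /eqP->.
by rewrite /comb big_seq1 rmorph1 scale1r subrr.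
Qed.

Lemma in_span_sum P (I : eqType) (r : seq I) (F : I -> M) :
  (forall i, i \in r -> in_span P (F i)) -> in_span P (\sum_(i <- r) F i).
Proof.
move=> h; rewrite big_seq; apply: (big_ind (in_span P)) => //.
- exact: in_span0.
- exact: in_spanD.
Qed.

Definition lead (g : A) (x : T) :=
  exists k, in_span (fun y => mlt y x) (iota (g ^+ k) *: mval x).

Lemma lead_mul g h x : lead g x -> lead (g * h) x.
Proof.
move=> [k gx]; exists k; rewrite exprMn mulrC rmorphM -scalerA; exact: in_spanZ.
Qed.

(** Multiply the expression for [x] by the cofactor [b]: by [mdvP] the monomials below [x] are
    carried to monomials below [y]. *)
Lemma lead_mdv g x y : mdv x y -> lead g x -> lead g y.
Proof.
move=> /mdvP[b [yE lower]] [k [s [a [us sx Nx]]]]; exists k.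
apply: (@in_span_mod _ _ (b *: comb s a)).
  by rewrite yE scalerA mulrC -scalerA -scalerBr; apply: NZ.
rewrite scaler_sumr; apply: in_span_sum => z /sx /lower[z' [z'y e]].
rewrite scalerA mulrC -scalerA -e; apply: in_spanZ; exact: in_span_mval.
Qed.

(** Otherwise there are successive nonzero multiples [G' i], each with a monomial that becomes
    leading only over [G' i.+1]. By Dickson one of these monomials divides a later one, which was
    therefore leading too early. *)
Lemma lead_maximal (g0 : A) : g0 != 0 ->
  exists h, g0 * h != 0 /\ forall h', g0 * h * h' != 0 ->
    forall x, lead (g0 * h * h') x -> lead (g0 * h) x.
Proof.
move=> g00; apply: contrapT => /forallNP nomax.
pose good g := g != 0 /\ exists h, g = g0 * h.
have step g : good g -> exists p : A * T,
    [/\ good (g * p.1), lead (g * p.1) p.2 & ~ lead g p.2].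
  move=> [gn0 [h gE]]; have /not_andP[//|] := nomax h; first by rewrite -gE.
  move=> /existsNP[h' /not_implyP[h'n0 /existsNP[x /not_implyP[lx nlx]]]].
  exists (h', x); rewrite gE; split=> //; split=> //.
  by exists (h * h'); rewrite mulrA.
have gg0 : good g0 by split=> //; exists 1; rewrite mulr1.
(* A default value for the choice function [F] where [good] fails. *)
have [p0 _] := step _ gg0.
have /choice[F FP] : forall g, exists p : A * T, good g ->
    [/\ good (g * p.1), lead (g * p.1) p.2 & ~ lead g p.2].
  move=> g; have [/step[p]|] := pselect (good g); first by exists p.
  by exists p0.
pose G' := fix G' i := if i is j.+1 then G' j * (F (G' j)).1 else g0.
have goodG i : good (G' i) by elim: i => //= i /FP[].
have leadG i j x : (i <= j)%N -> lead (G' i) x -> lead (G' j) x.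
  move=> ij; elim: j ij => [|j ih]; first by rewrite leqn0 => /eqP->.
  by rewrite leq_eqVlt => /orP[/eqP->//|/ih h /h]; apply: lead_mul.
have [phi [mono phiP]] := dickson (fun i => (F (G' i)).2).
have lt01 := mono 0%N 1%N isT.
have [_ l0 _] := FP _ (goodG (phi 0%N)); have [_ _] := FP _ (goodG (phi 1%N)); apply.
(* The first monomial is leading over the multiple of index [(phi 0).+1], which is at most
   [phi 1]. *)
apply: lead_mdv (phiP 0%N 1%N isT) _; exact: leadG lt01 l0.
Qed.

(** A basis of [(M/N)[1/g]] over [A[1/g]], stated without fractions. A single factor [g] suffices in
    the independence clause: a coefficient with [g * a x] nonzero yields a nonzero multiple of [g]
    to which maximality can be applied. *)
Definition standard_basis (g : A) (std : T -> Prop) :=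
  (forall v, exists k, in_span std (iota (g ^+ k) *: v)) /\
  forall (s : seq T) (a : T -> A), uniq s -> (forall x, x \in s -> std x) ->
    N (comb s a) -> forall x, x \in s -> g * a x = 0.

Lemma max_mlt (s : seq T) (P : T -> Prop) : (exists2 x, x \in s & P x) ->
  exists x, [/\ x \in s, P x & forall y, y \in s -> P y -> y = x \/ mlt y x].
Proof.
elim: s => [[]//|z s ih] [x]; rewrite inE => xs Px.
have [[y ys Py]|nex] := pselect (exists2 x, x \in s & P x); last first.
  have xz : x = z by case/orP: xs => [/eqP//|xs]; case: nex; exists x.
  exists z; rewrite inE eqxx -xz; split=> // y.
  by rewrite inE => /orP[/eqP->|ys Py]; [left|case: nex; exists y].
have [w [ws Pw wmax]] := ih (ex_intro2 _ _ y ys Py).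
have [Pz|nPz] := pselect (P z); last first.
  exists w; rewrite inE ws orbT; split=> // t.
  by rewrite inE => /orP[/eqP->//|]; exact: wmax.
have [zw|zw|wz] := mlt_total z w.
- exists w; rewrite inE ws orbT; split=> // t.
  by rewrite inE => /orP[/eqP->|]; [right|exact: wmax].
- exists w; rewrite inE ws orbT; split=> // t.
  by rewrite inE => /orP[/eqP->|]; [left|exact: wmax].
- exists z; rewrite inE eqxx; split=> // t.
  rewrite inE => /orP[/eqP->|ts Pt]; first by left.
  by have [->|tw] := wmax t ts Pt; right=> //; exact: mlt_trans wz.
Qed.

Hypothesis reducedA : forall (a : A) n, a ^+ n = 0 -> a = 0.
Hypothesis span : forall v, in_span (fun=> True) v.

(* Choose a multiple g of g0 for which the set of leading monomials over A[1/g]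
   is maximal.  A relation between the other monomials with leading
   coefficient a such that g a <> 0 would make a new monomial leading over
   A[1/(g a)]. *)
Lemma standard_basis_exists (g0 : A) : g0 != 0 ->
  exists h std, g0 * h != 0 /\ standard_basis (g0 * h) std.
Proof.
move=> /lead_maximal[h []]; set g := g0 * h => gn0 gmax.
exists h, (fun x => ~ lead g x); split=> //; split.
  have genD u v : (exists k, in_span (fun x => ~ lead g x) (iota (g ^+ k) *: u)) ->
      (exists k, in_span (fun x => ~ lead g x) (iota (g ^+ k) *: v)) ->
      exists k, in_span (fun x => ~ lead g x) (iota (g ^+ k) *: (u + v)).
    move=> [k ku] [l lv]; exists (k + l)%N; rewrite scalerDr; apply: in_spanD.
      by rewrite exprD mulrC rmorphM -scalerA; apply: in_spanZ.
    by rewrite exprD rmorphM -scalerA; apply: in_spanZ.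
  have gen_comb (s : seq T) a : (forall x, x \in s ->
      exists k, in_span (fun x => ~ lead g x) (iota (g ^+ k) *: mval x)) ->
      exists k, in_span (fun x => ~ lead g x) (iota (g ^+ k) *: comb s a).
    move=> hs; rewrite /comb big_seq.
    apply: (big_ind (fun v => exists k, in_span _ (iota (g ^+ k) *: v))) => //.
      by exists 0%N; rewrite scaler0; exact: in_span0.
    move=> x /hs[k kx]; exists k.
    by rewrite scalerA mulrC -scalerA; apply: in_spanZ.
  (* Induction on the monomial order: a leading monomial is replaced, up to a power of [g], by
     smaller ones. *)
  have gen (x : T) : exists k, in_span (fun x => ~ lead g x) (iota (g ^+ k) *: mval x).
    elim/(well_founded_ind (@mlt_wf _ _ _ T)): x => x ih.
    have [[k [s [a [us sx Nx]]]]|nl] := pselect (lead g x); last first.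
      by exists 0%N; rewrite expr0 rmorph1 scale1r; exact: in_span_mval.
    have [l lP] := gen_comb s a (fun y ys => ih y (sx y ys)).
    exists (l + k)%N; rewrite exprD rmorphM -scalerA; apply: in_span_mod lP.
    by rewrite -scalerBr; apply: NZ.
  move=> v; have [s [a [us _ Nv]]] := span v.
  have [k kP] := gen_comb s a (fun x _ => gen x).
  by exists k; apply: in_span_mod kP; rewrite -scalerBr; apply: NZ.
move=> s a us sstd Ns x xs; apply: contrapT => /eqP gax.
have [y [ys /= gay ymax]] := @max_mlt s (fun x => g * a x != 0) (ex_intro2 _ _ x xs gax).
have ggay : g * (g * a y) != 0.
  apply: contra_neq gay => e; apply: (@reducedA _ 2).
  by rewrite expr2 [X in X * _]mulrC -mulrA e mulr0.
apply: (sstd y ys); apply: (gmax (a y)) => //; exists 1%N; rewrite expr1.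
(* Multiplication by [g] removes the terms above [y], by the choice of [y], so [g * a y] times [y]
   is a combination of smaller monomials. *)
have := NZ (iota g) Ns; rewrite /comb (big_rem y) //= scalerDr => Nsum.
apply: (@in_span_mod _ _ (- (iota g *: \sum_(z <- rem y s) iota (a z) *: mval z))).
  by rewrite opprK rmorphM -scalerA.
rewrite -scaleN1r -(rmorph1 iota) -rmorphN; apply: in_spanZ.
rewrite scaler_sumr; apply: in_span_sum => z.
rewrite mem_rem_uniq // inE => /andP[zy zs]; rewrite scalerA -rmorphM.
have [->|gaz] := eqVneq (g * a z) 0; first by rewrite rmorph0 scale0r; exact: in_span0.
by apply/in_spanZ/in_span_mval; have [e|//] := ymax z zs gaz; rewrite e eqxx in zy.
Qed.

(** A common exponent, the sum of the individual ones, and a common support for finitely many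
    vectors. *)
Lemma standard_basis_family (g : A) std (J : finType) (u : J -> M) :
  standard_basis g std ->
  exists k (s : seq T) (c : J -> T -> A),
    [/\ uniq s, forall x, x \in s -> std x
      & forall j, N (iota (g ^+ k) *: u j - comb s (c j))].
Proof.
move=> [gen _].
have /choice[k kP] : forall j, exists k, in_span std (iota (g ^+ k) *: u j) by [].
pose K := \sum_j k j.
have /choice[s sP] : forall j, in_span std (iota (g ^+ K) *: u j).
  move=> j; rewrite /K (bigD1 j) //= exprD mulrC rmorphM -scalerA; exact: in_spanZ.
have /choice[c cP] := sP.
pose t := undup (flatten [seq s j | j <- enum J]).
have st j : {subset s j <= t}.
  move=> x xs; rewrite mem_undup; apply/flattenP; exists (s j) => //.
  by apply: map_f; rewrite mem_enum.
exists K, t, (fun j x => if x \in s j then c j x else 0); split.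
- exact: undup_uniq.
- move=> x; rewrite mem_undup => /flattenP[_ /mapP[j _ ->] xs].
  by have [_ + _] := cP j; apply.
- move=> j; have [us _ Nj] := cP j.
  by rewrite -comb_extend //; exact: undup_uniq.
Qed.

End LeadingTerms.

(** * Localization *)

Section Units.
Context (R : comPzRingType).

Lemma is_unit1 : is_unit (1 : R).
Proof. by exists 1; rewrite mulr1. Qed.

Lemma is_unitM (r s : R) : is_unit r -> is_unit s -> is_unit (r * s).
Proof. by move=> [r' e] [s' e']; exists (r' * s'); rewrite mulrACA e e' mulr1. Qed.

Lemma is_unitX (r : R) n : is_unit r -> is_unit (r ^+ n).
Proof.
move=> ur; elim: n => [|n ih]; first exact: is_unit1.
by rewrite exprS; apply: is_unitM.
Qed.

Lemma is_unit_mul (r s : R) : is_unit (r * s) -> is_unit r.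
Proof. by move=> [t e]; exists (s * t); rewrite mulrA. Qed.

Lemma is_unit_morph (R' : comPzRingType) (f : {rmorphism R -> R'}) r :
  is_unit r -> is_unit (f r).
Proof. by move=> [s e]; exists (f s); rewrite -rmorphM e rmorph1. Qed.

Lemma unit_scaleI (M : lmodType R) (r : R) (u v : M) : is_unit r ->
  r *: u = r *: v -> u = v.
Proof.
move=> [s e] /(congr1 (fun w => s *: w)).
by rewrite !scalerA mulrC e !scale1r.
Qed.

Lemma unit_mulI (r u v : R) : is_unit r -> r * u = r * v -> u = v.
Proof.
move=> [s e] /(congr1 (fun w => s * w)).
by rewrite !mulrA [s * r]mulrC e !mul1r.
Qed.

(** A common denominator: the product of the individual ones works because [Q] is stable under
    multiples. *)
Lemma common_unit (A : comPzRingType) (f : {rmorphism A -> R}) (I : finType)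
    (Q : I -> A -> Prop) :
  (forall i s t, Q i t -> Q i (s * t)) ->
  (forall i, exists2 t, is_unit (f t) & Q i t) ->
  exists2 t, is_unit (f t) & forall i, Q i t.
Proof.
move=> QM /= ex; have /choice[t tP] : forall i, exists t, is_unit (f t) /\ Q i t.
  by move=> i; have [t] := ex i; exists t.
exists (\prod_i t i).
  rewrite rmorph_prod; apply: (big_ind (@is_unit R)); first exact: is_unit1.
    exact: is_unitM.
  by move=> i _; have [] := tP i.
by move=> i; rewrite (bigD1 i) //= mulrC; apply: QM; have [] := tP i.
Qed.

End Units.

(** * Flatness of localizations from a standard basis *)

Section LocalFlatness.
Context (A B : comPzRingType) (iota : {rmorphism A -> B}) (M : lmodType B).
Context (N : set M) (G : set B) (T : monomials M G).
Hypothesis N0 : N 0.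
Hypothesis ND : forall u v, N u -> N v -> N (u + v).
Hypothesis NZ : forall b u, N u -> N (b *: u).
Context (g : A) (std : T -> Prop).
Hypothesis gstd : standard_basis iota N g std.

Context (R S : comPzRingType) (theta : {rmorphism R -> S}) (F : lmodType S).
Context (alpha : {rmorphism A -> R}) (beta : {rmorphism B -> S}).
Hypothesis comm : forall a, theta (alpha a) = beta (iota a).
Hypothesis unit_g : is_unit (alpha g).
Hypothesis fracR : forall r, exists2 t, is_unit (alpha t) &
  exists a, alpha t * r = alpha a.
Context (psi : {additive M -> F}).
Hypothesis psiZ : forall b u, psi (b *: u) = beta b *: psi u.
Hypothesis psiN : forall u, N u -> psi u = 0.
Hypothesis fracF : forall m, exists2 t, is_unit (beta t) &
  exists u, beta t *: m = psi u.
Hypothesis kerF : forall u, psi u = 0 ->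
  exists2 t, is_unit (beta t) & N (t *: u).

(** The hypotheses make [F] a localization of [M/N] and [R] one of the image of [A]. Denominators
    are cleared, the numerators are expanded in standard monomials, and the images of these
    monomials trivialise the relations. *)
Lemma equational_localization : equational (rscal theta F).
Proof.
move=> J L m r rel.
have relF l : \sum_j theta (r l j) *: (m j : F) = 0 by exact: rel.
have [t ut [u uE]] : exists2 t, is_unit (beta t) & exists u : J -> M,
    forall j, beta t *: (m j : F) = psi (u j).
  have [|t ut h] := @common_unit S B beta J
    (fun j t => exists u, beta t *: (m j : F) = psi u) _ (fun j => fracF (m j)).
    by move=> j s t [u e]; exists (s *: u); rewrite rmorphM -scalerA e psiZ.
  by have /choice[u uE] := h; exists t => //; exists u.
have [s us [a aE]] : exists2 s, is_unit (alpha s) & exists a : L * J -> A,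
    forall p, alpha s * r p.1 p.2 = alpha (a p).
  have [|s us h] := @common_unit R A alpha (L * J)%type
    (fun p s => exists a, alpha s * r p.1 p.2 = alpha a) _ (fun p => fracR (r p.1 p.2)).
    by move=> p s s' [a e]; exists (s * a); rewrite rmorphM -mulrA e rmorphM.
  by have /choice[a aE] := h; exists s => //; exists a.
(* The numerator of relation [l]. Its image in [F] is zero, so a denominator [t'] moves it into
   [N]. *)
pose w l := \sum_j iota (a (l, j)) *: u j.
have psiw l : psi (w l) = 0.
  transitivity (beta (iota s * t) *: \sum_j theta (r l j) *: (m j : F)).
    rewrite raddf_sum scaler_sumr; apply: eq_bigr => j _.
    rewrite psiZ -comm -aE /= rmorphM -uE !scalerA rmorphM -comm.
    by congr (_ *: _); ring.
  by rewrite relF scaler0.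
have [t' ut' Nw] : exists2 t', is_unit (beta t') & forall l, N (t' *: w l).
  apply: common_unit => [l b b' h|l]; first by rewrite -scalerA; apply: NZ.
  exact: kerF.
have [k [q [c [uq qstd cE]]]] := standard_basis_family NZ (fun j => t' *: u j) gstd.
have ugk : is_unit (beta (iota (g ^+ k))).
  by rewrite -comm !rmorphXn; apply/is_unitX/is_unit_morph.
have Ncomb l : N (comb iota q (fun x => \sum_j a (l, j) * c j x)).
  have -> : comb iota q (fun x => \sum_j a (l, j) * c j x) =
      iota (g ^+ k) *: (t' *: w l) - \sum_j iota (a (l, j)) *:
        (iota (g ^+ k) *: (t' *: u j) - comb iota q (c j)).
    rewrite comb_lin !scaler_sumr -sumrB; apply: eq_bigr => j _.
    rewrite scalerBr !scalerA opprB.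
    have -> : iota (g ^+ k) * t' * iota (a (l, j))
      = iota (a (l, j)) * (iota (g ^+ k) * t') by ring.
    by rewrite addrCA subrr addr0.
  apply: (submod_sub ND NZ); first exact/NZ/Nw.
  by apply: (big_ind N) => // j _; apply: NZ.
(* The total denominator: [v] times [m j] is the image of the combination of standard monomials with
   coefficients [c j]. *)
pose v : B := iota (g ^+ k) * t' * t.
have [v' vv'] : is_unit (beta v).
  by rewrite !rmorphM; apply: is_unitM ut; apply: is_unitM ut'.
pose e (i : 'I_(size q)) := tnth (in_tuple q) i.
exists 'I_(size q), (fun x => v' *: psi (mval (e x)) : rscal theta F).
exists (fun j x => alpha (c j (e x))); split=> [j|l x].
  apply: (@unit_scaleI _ F (beta v)); first by exists v'.
  rewrite scaler_sumr.
  transitivity (psi (comb iota q (c j))).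
    apply/eqP; rewrite -subr_eq0; apply/eqP.
    have := psiN (cE j); rewrite raddfB !psiZ -uE !scalerA -!rmorphM => h.
    by rewrite -[RHS]h; congr (beta _ *: _ - _).
  rewrite /comb raddf_sum big_tnth; apply: eq_bigr => i _.
  rewrite psiZ -comm; transitivity (theta (alpha (c j (e i))) *:
    ((beta v * v') *: psi (mval (e i)))); first by rewrite vv' scale1r.
  by rewrite !scalerA; congr (_ *: _); ring.
(* Independence gives the vanishing up to the factor [g]; both [g] and the denominator [s] are
   invertible in [R]. *)
apply: (unit_mulI us); rewrite mulr0 mulr_sumr.
transitivity (alpha (\sum_j a (l, j) * c j (e x))).
  rewrite rmorph_sum; apply: eq_bigr => j _.
  by rewrite mulrA (aE (l, j)) rmorphM.
apply: (unit_mulI unit_g); rewrite mulr0 -rmorphM -(rmorph0 alpha); congr (alpha _).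
by apply: (gstd.2 q (fun x => \sum_j a (l, j) * c j x)) (mem_tnth x (in_tuple q)).
Qed.

End LocalFlatness.

(** * Germs and prime ideals *)

(** By Zorn there is a maximal ideal among those that contain [I] and no power of [h]; it is
    prime. *)
Lemma exists_prime_avoiding (R : comPzRingType) (I : set R) (h : R) :
  is_ideal I -> (forall n, ~ I (h ^+ n)) ->
  exists p : spec R, I `<=` p /\ ~ (p : set R) h.
Proof.
move=> Iid Ih.
pose P (J : set R) := J = set0 \/ [/\ is_ideal J, I `<=` J & forall n, ~ J (h ^+ n)].
have PI : P I by right; split.
have chain (C : set (set R)) : C `<=` P -> total_on C subset ->
    P (\bigcup_(J in C) J).
  move=> CP Ctot; have [[J CJ Jn0]|none] := pselect (exists2 J, C J & J <> set0); last first.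
    left; apply/seteqP; split=> // x [J CJ Jx]; apply: none.
    by exists J => // J0; rewrite J0 in Jx.
  right; have good J' : C J' -> J' !=set0 ->
      [/\ is_ideal J', I `<=` J' & forall n, ~ J' (h ^+ n)].
    by move=> /CP[->[]|].
  have [Jid IJ _] := good J CJ (proj1 (set0P J) (introN eqP Jn0)).
  split.
  - split=> [|a b [K CK Ka] [L CL Lb]|a b [K CK Kb]].
    + by exists J => //; have [] := Jid.
    + have [KL|LK] := Ctot K L CK CL.
        have [[_ LD _] _ _] := good L CL (ex_intro _ b Lb).
        by exists L => //; apply: LD => //; exact: KL.
      have [[_ KD _] _ _] := good K CK (ex_intro _ a Ka).
      by exists K => //; apply: KD => //; exact: LK.
    + have [[_ _ KM] _ _] := good K CK (ex_intro _ b Kb).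
      by exists K => //; exact: KM.
  - by move=> x /IJ Jx; exists J.
  - by move=> n [K CK Kh]; have [_ _ /(_ n)] := good K CK (ex_intro _ _ Kh).
have [J [PJ Jmax]] := Zorn_bigcup chain.
case: PJ => [J0|[[J0 JD JM] IJ Jh]].
  case: (Jmax I) => //; rewrite J0; split=> // /(_ 0); apply.
  by case: Iid.
(* By maximality, adjoining an element outside [J] produces an ideal that contains a power of
   [h]. *)
have grow a : ~ J a -> exists n y c, J c /\ h ^+ n = c + y * a.
  move=> Ja; pose K := [set x | exists y c, J c /\ x = c + y * a].
  have JK : J `<=` K by move=> x Jx; exists 0, x; rewrite mul0r addr0.
  have Ka : K a by exists 1, 0; rewrite mul1r add0r.
  have nPK : ~ P K by apply: Jmax; split=> // /(_ a Ka).
  apply: contrapT => nh; apply: nPK; right; split; last 2 first.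
  - by move=> x /IJ /JK.
  - by move=> n [y [c [Jc e]]]; apply: nh; exists n, y, c.
  split; first exact: JK.
  - move=> _ _ [y [c [Jc ->]]] [y' [c' [Jc' ->]]].
    by exists (y + y'), (c + c'); split; [exact: JD|ring].
  - move=> b _ [y [c [Jc ->]]].
    by exists (b * y), (b * c); split; [exact: JM|ring].
have Jprime : is_prime_ideal J.
  split=> // [|a b Jab]; first by have := Jh 0%N; rewrite expr0.
  apply: contrapT => /not_orP[/grow[n [y [c [Jc e]]]] /grow[n' [y' [c' [Jc' e']]]]].
  apply: (Jh (n + n')%N); rewrite exprD e e'.
  have -> : (c + y * a) * (c' + y' * b)
    = (c' + y' * b) * c + (y * a * c' + y * y' * (a * b)) by ring.
  by apply: (JD _ _ (JM _ _ Jc)); apply: JD; apply: JM.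
exists (Spec Jprime); split=> //= Jh1; by apply: (Jh 1%N); rewrite expr1.
Qed.

(** If no power of [e] killed [a], some prime would contain the annihilator of [a] and avoid [e]. *)
Lemma prime_annihilator (R : comPzRingType) (a e : R) :
  (forall q : spec R, ~ (q : set R) e -> exists t, ~ (q : set R) t /\ t * a = 0) ->
  exists n, e ^+ n * a = 0.
Proof.
move=> h; apply: contrapT => /forallNP ne.
have [|n|q [aq /h[t [qt ta]]]] :=
    @exists_prime_avoiding R [set t | t * a = 0] e.
- split=> /= [|x y xa ya|x y ya]; first by rewrite mul0r.
    by rewrite mulrDl xa ya addr0.
  by rewrite -mulrA ya mulr0.
- exact: ne.
- by apply: qt; exact: aq.
Qed.

Section Germs.
Context (X : ringedSpace).

Section GermMorphism.
Context (x : X) (U : opens X) (Ux : oset U x).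

Lemma ogerm_zmod : zmod_morphism (ogerm Ux).
Proof.
move=> s t; rewrite -[RHS]/(ostalk_add (ogerm Ux s) (ostalk_opp (ogerm Ux t))).
by rewrite ostalk_oppE ostalk_addE.
Qed.
Lemma ogerm_monoid : monoid_morphism (ogerm Ux).
Proof.
split=> [|s t]; first by rewrite -ostalk_oneE.
by rewrite -ostalk_mulE.
Qed.
HB.instance Definition _ :=
  GRing.isZmodMorphism.Build ('O U) (ostalk x) (ogerm Ux) ogerm_zmod.
HB.instance Definition _ :=
  GRing.isMonoidMorphism.Build ('O U) (ostalk x) (ogerm Ux) ogerm_monoid.

(* Keeps ogerm visible on the right-hand side, unlike rmorphM and rmorph0. *)
Lemma ogermM s t : ogerm Ux (s * t) = ogerm Ux s * ogerm Ux t.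
Proof. exact: rmorphM. Qed.
Lemma ogermX s n : ogerm Ux (s ^+ n) = ogerm Ux s ^+ n.
Proof. exact: rmorphXn. Qed.
Lemma ogerm0 : ogerm Ux 0 = 0.
Proof. exact: rmorph0. Qed.
End GermMorphism.

Lemma ogerm_eq_near (x : X) (U V : opens X) (Ux : oset U x) (Vx : oset V x) s t :
  ogerm Ux s = ogerm Vx t -> exists W : opens X, oset W x /\
    forall z (Uz : oset U z) (Vz : oset V z), oset W z -> ogerm Uz s = ogerm Vz t.
Proof.
move=> /germP[W [WU [WV [Wx e]]]]; exists W; split=> // z Uz Vz Wz.
by rewrite -(ogerm_res WU Uz Wz) -(ogerm_res WV Vz Wz); congr (ogerm _ _).
Qed.

Lemma ogerm_unit_near (x : X) (U : opens X) (Ux : oset U x) s :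
  is_unit (ogerm Ux s) -> exists W : opens X, oset W x /\
    forall z (Uz : oset U z), oset W z -> is_unit (ogerm Uz s).
Proof.
move=> [r]; have [V [Vx [t ->]]] := stalkP r; rewrite -/(ogerm Vx t).
have Ix : oset (opensI U V) x by [].
rewrite -(ogerm_res (@opensIl _ U V) Ux Ix) -(ogerm_res (@opensIr _ U V) Vx Ix).
rewrite -rmorphM -(rmorph1 (ogerm Ix)) => /ogerm_eq_near[W [Wx WE]].
exists (opensI (opensI U V) W); split=> // z Uz [Iz Wz].
have := WE z Iz Iz Wz; rewrite rmorphM rmorph1 => e.
by rewrite -(ogerm_res (@opensIl _ U V) Uz Iz); exists (ogerm Iz (rs_res (@opensIr _ U V) t)).
Qed.

(** Uniqueness of gluing: [s] and [0] both glue the zero sections of a cover on which [s]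
    vanishes. *)
Lemma section_eq0 (U : opens X) (s : 'O U) :
  (forall x (Ux : oset U x), ogerm Ux s = 0) -> s = 0.
Proof.
move=> s0; have /choice[V VP] : forall x : set_type U, exists V : opens X,
    oset V (set_val x) /\ exists VU : V `<=` U, rs_res VU s = 0.
  move=> x; have Ux : oset U (set_val x) by exact/set_mem/(valP x).
  have := s0 _ Ux; rewrite -(rmorph0 (ogerm Ux)) => /germP[W [WU [WU' [Wx e]]]].
  exists W; split=> //; exists WU; rewrite -(rmorph0 (rs_res WU)).
  by rewrite [LHS]e; congr (rs_res _ _); exact: Prop_irrelevance.
have VU x : V x `<=` U by have [_ []] := VP x.
have res0 x : rs_res (VU x) s = 0.
  have [_ [h e]] := VP x; rewrite -[RHS]e.
  by congr (rs_res _ _); exact: Prop_irrelevance.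
have cov : U `<=` \bigcup_x V x.
  by move=> x Ux; exists (exist _ x (mem_set Ux)) => //; have [] := VP (exist _ x (mem_set Ux)).
have [|t [_ tuniq]] := rs_sheaf VU cov (s := fun x => 0).
  by move=> i j /=; rewrite !rmorph0.
by rewrite -(tuniq s) ?(tuniq 0) // => i; exact: rmorph0.
Qed.

End Germs.

(** * Stalks under isomorphisms and restriction to open subsets *)

Section IsoStalks.
Context (X Y : ringedSpace) (f : rsMorphism X Y).
Hypothesis fiso : is_iso f.

Lemma iso_open_image (Z : opens X) (x : X) : oset Z x ->
  exists D : opens Y, oset D (f x) /\ rm_preim f D `<=` Z.
Proof.
move=> Zx; have [fb fo _] := fiso.
exists (Opens (fo Z (open_oset Z))); split; first by exists x.
by move=> z [y Zy /(bij_inj fb) <-].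
Qed.

Lemma iso_stalk_map_inj x : injective (stalk_map f x).
Proof.
move=> a b; have [U [Ux [s [t [-> ->]]]]] := stalkP2 a b.
rewrite -!/(ogerm _ _) !stalk_mapE => /germP[Z [ZU [ZU' [Zx e]]]].
have [D [Dx DZ]] := iso_open_image Zx.
have [_ _ /(_ (opensI D U)) /bij_inj sinj] := fiso.
have DU : opensI D U `<=` U by exact: opensIr.
apply/germP; exists (opensI D U), DU, DU; split=> //; apply: sinj.
have h : rm_preim f (opensI D U) `<=` rm_preim f U by move=> z /DU.
have h' : rm_preim f (opensI D U) `<=` Z by move=> z [/DZ].
rewrite /= -!(rm_nat DU h).
have := congr1 (rs_res h') e; rewrite /= !(rs_res_comp _ _ h); exact.
Qed.

Lemma iso_stalk_map_surj x (r : ostalk x) : exists a, stalk_map f x a = r.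
Proof.
have [Z [Zx [s ->]]] := stalkP r.
have [D [Dx DZ]] := iso_open_image Zx.
have [_ _ /(_ D)[g gK Kg]] := fiso.
exists (ogerm Dx (g (rs_res DZ s))); rewrite stalk_mapE Kg.
exact: (ogerm_res DZ Zx (Dx : oset (rm_preim f D) x) s).
Qed.
End IsoStalks.

Section RestrictedStalk.
Context (X : ringedSpace) (U : opens X) (P : presheaf X).

(** The canonical bijection between a stalk of the restriction and the original stalk; the two
    quotients are distinct types. *)
Definition stalk_ext (x : set_type U) (a : stalk (restrict_presheaf U P) x) :
    stalk P (set_val x) :=
  let g := rep a in
  germ (imageP set_val (gmem g) : oset (oimage (gdom g)) (set_val x)) (gsec g).

Lemma stalk_extE (x : set_type U) (V : opens (set_type U)) (Vx : oset V x)
    (Vx' : oset (oimage V) (set_val x)) (s : P (oimage V)) :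
  stalk_ext (germ Vx (s : restrict_presheaf U P V)) = germ Vx' s.
Proof.
rewrite /stalk_ext.
have [] := repP (germ_equiv (restrict_presheaf U P) x)
  (Pregerm Vx (s : restrict_presheaf U P V)).
rewrite -!/(germ _ _).
move: (rep _) => [A Ax a] W [/= WA [WV [Wx e]]].
apply/germP; exists (oimage W), (oimageS WA), (oimageS WV); split=> //.
exact: imageP.
Qed.

Lemma oimage_small (Z : opens X) (x : set_type U) : oset Z (set_val x) ->
  exists V : opens (set_type U), oset V x /\ oimage V `<=` Z.
Proof.
move=> Zx; have Vo : open (set_val @^-1` Z : set (set_type U)).
  by exists Z => //; exact: open_oset.
by exists (Opens Vo); split=> // _ [y Zy <-].
Qed.

Lemma stalk_ext_inj (x : set_type U) : injective (@stalk_ext x).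
Proof.
move=> a b; have [V [Vx [s [t [-> ->]]]]] := stalkP2 a b.
have Vx' : oset (oimage V) (set_val x) by exact: imageP.
rewrite !(stalk_extE _ Vx') => /germP[Z [ZV [ZV' [Zx e]]]].
have [W [Wx WZ]] := oimage_small Zx.
have WV : W `<=` V.
  by move=> z Wz; apply: oimageK; apply/ZV/WZ; exact: imageP.
apply/germP; exists W, WV, WV; split=> //=.
have := congr1 (pres WZ) e; rewrite !(pres_comp _ _ (oimageS WV)); exact.
Qed.

Lemma stalk_ext_surj (x : set_type U) (b : stalk P (set_val x)) :
  exists a, @stalk_ext x a = b.
Proof.
have [Z [Zx [s ->]]] := stalkP b.
have [V [Vx VZ]] := oimage_small Zx.
have Vx' : oset (oimage V) (set_val x) by exact: imageP.
exists (germ Vx (pres VZ s : restrict_presheaf U P V)).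
by rewrite (stalk_extE _ Vx') germ_res.
Qed.
End RestrictedStalk.

Section RestrictedRingStalk.
Context (X : ringedSpace) (U : opens X) (x : Defs.restrict U).

Definition ostalk_ext (a : ostalk x) : ostalk (set_val x : X) :=
  @stalk_ext X U (O_presheaf X) x a.

Lemma ostalk_extE (V : opens (Defs.restrict U)) (Vx : oset V x)
    (Vx' : oset (oimage V) (set_val x : X)) (s : 'O V) :
  ostalk_ext (ogerm Vx s) = @ogerm X _ (oimage V) Vx' s.
Proof. exact: (@stalk_extE X U (O_presheaf X)). Qed.

Lemma ostalk_ext_zmod : zmod_morphism ostalk_ext.
Proof.
move=> a b; have [V [Vx [s [t [-> ->]]]]] := stalkP2 a b.
have Vx' : oset (oimage V) (set_val x : X) by exact: imageP.
rewrite -!/(ogerm _ _) -(raddfB (ogerm Vx)) !(ostalk_extE _ Vx').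
exact: (raddfB (ogerm Vx')).
Qed.

Lemma ostalk_ext_monoid : monoid_morphism ostalk_ext.
Proof.
split=> [|a b].
  have Tx : oset (oimage (oT (Defs.restrict U))) (set_val x : X) by exact: imageP.
  by rewrite [LHS](@ostalk_extE (oT (Defs.restrict U)) I Tx 1) (rmorph1 (ogerm Tx)).
have [V [Vx [s [t [-> ->]]]]] := stalkP2 a b.
have Vx' : oset (oimage V) (set_val x : X) by exact: imageP.
rewrite -!/(ogerm _ _) -(rmorphM (ogerm Vx)) !(ostalk_extE _ Vx').
exact: (rmorphM (ogerm Vx')).
Qed.

HB.instance Definition _ := GRing.isZmodMorphism.Build
  (ostalk x) (ostalk (set_val x : X)) ostalk_ext ostalk_ext_zmod.
HB.instance Definition _ := GRing.isMonoidMorphism.Build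
  (ostalk x) (ostalk (set_val x : X)) ostalk_ext ostalk_ext_monoid.

Context (F : omodule X).

Definition mstalk_ext (a : mstalk (restrict_mod U F) x) :
    mstalk F (set_val x : X) :=
  @stalk_ext X U (om_presheaf F) x a.

Lemma mstalk_extE (V : opens (Defs.restrict U)) (Vx : oset V x)
    (Vx' : oset (oimage V) (set_val x : X)) (s : F (oimage V)) :
  mstalk_ext (mgerm (F := restrict_mod U F) Vx s) = @mgerm X F _ (oimage V) Vx' s.
Proof. exact: (@stalk_extE X U (om_presheaf F)). Qed.

Lemma mstalk_extD a b : mstalk_ext (a + b) = mstalk_ext a + mstalk_ext b.
Proof.
have [V [Vx [s [t [-> ->]]]]] := stalkP2 a b.
have Vx' : oset (oimage V) (set_val x : X) by exact: imageP.
rewrite -!/(mgerm _ _); rewrite !(mstalk_extE _ Vx').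
rewrite -[RHS]/(mstalk_add _ _) mstalk_addE -(mstalk_extE Vx); congr mstalk_ext.
exact: (@mstalk_addE _ (restrict_mod U F) x V Vx).
Qed.

Lemma mstalk_extZ (r : ostalk x) (a : mstalk (restrict_mod U F) x) :
  mstalk_ext (r *: a) = ostalk_ext r *: mstalk_ext a.
Proof.
have [V [Vx [s [t [-> ->]]]]] := stalkP2 r a.
have Vx' : oset (oimage V) (set_val x : X) by exact: imageP.
rewrite -!/(mgerm _ _) -!/(ogerm _ _) !(mstalk_extE _ Vx') (ostalk_extE _ Vx').
rewrite -[RHS]/(mstalk_scale _ _) mstalk_scaleE -(mstalk_extE Vx); congr mstalk_ext.
exact: (@mstalk_scaleE _ (restrict_mod U F) x V Vx).
Qed.
End RestrictedRingStalk.

(** * Affine charts *)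

Section SpecStalks.
Context (A : comPzRingType).
Local Notation SA := (Spec_rs A).

Definition spec_cst (a : A) : spec_sec (oT SA) := SpecSec (@sec_cst_frac A (oT SA) a).

Lemma spec_cst_zmod : zmod_morphism spec_cst.
Proof.
move=> a b; apply: spec_sec_eq => p Up /=.
rewrite -[RHS]/(loc_add _ (loc_opp _)) loc_oppE loc_addE; apply: frac_eq; ring.
Qed.
Lemma spec_cst_monoid : monoid_morphism spec_cst.
Proof.
split=> [|a b]; apply: spec_sec_eq => p Up //=.
rewrite -[RHS]/(loc_mul _ _) loc_mulE; apply: frac_eq; ring.
Qed.
HB.instance Definition _ := GRing.isZmodMorphism.Build A
  (spec_sec (oT SA)) spec_cst spec_cst_zmod.
HB.instance Definition _ := GRing.isMonoidMorphism.Build A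
  (spec_sec (oT SA)) spec_cst spec_cst_monoid.

Definition spec_germ (p : SA) (a : A) : ostalk p := @ogerm SA p (oT SA) I (spec_cst a).

Lemma spec_germM (p : SA) a b : spec_germ p (a * b) = spec_germ p a * spec_germ p b.
Proof. by rewrite /spec_germ !rmorphM. Qed.

Lemma basic_open_proof (b : A) : open ([set q : spec A | ~ (q : set A) b]).
Proof.
exists [set b]; apply/seteqP; split=> q /= qb.
  by move=> /(_ b erefl).
by move=> qb'; apply: qb => _ ->.
Qed.

Definition basic_open (b : A) : opens SA := Opens (basic_open_proof b).

Lemma spec_basis (Z : opens SA) (p : spec A) : oset Z p ->
  exists b, ~ (p : set A) b /\ basic_open b `<=` Z.
Proof.
have [E ZE] : zariski_open (oset Z) := open_oset Z.
have ZP (q : spec A) : oset Z q = (~ E `<=` q) := congr1 (fun S => S q) ZE.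
rewrite ZP => /existsNP[b /not_implyP[Eb pb]]; exists b; split=> //.
by move=> q qb; rewrite ZP => /(_ b Eb).
Qed.

(** Evaluation at [p] is well defined on germs and turns their identities into identities of
    fractions. *)
Lemma spec_sec_germ (p : SA) (U V : opens SA) (Up : oset U p) (Vp : oset V p)
    (s : spec_sec U) (t : spec_sec V) :
  @ogerm SA p U Up s = @ogerm SA p V Vp t -> s p Up = t p Vp.
Proof.
move=> /germP[W [WU [WV [Wp /(congr1 (fun u : spec_sec W => u p Wp)) /= e]]]].
by rewrite (Prop_irrelevance Up (WU _ Wp)) e (Prop_irrelevance Vp (WV _ Wp)).
Qed.

Lemma spec_germ_frac (p : SA) (r : ostalk p) :
  exists a b, ~ (p : set A) b /\ spec_germ p b * r = spec_germ p a.
Proof.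
have [U [Up [s ->]]] := stalkP r.
have [V [a [b [Vp VU sV]]]] := sec_frac s Up.
have [pb _] := sV p Up Vp; exists a, b; split=> //.
have Tp : oset (opensI (oT SA) V) p by [].
rewrite -!/(ogerm _ _) /spec_germ.
rewrite -(@ogerm_res SA p U V VU Up Vp) -!(@ogerm_res SA p (oT SA) V (fun _ _ => I) I Vp).
rewrite -(rmorphM (ogerm Vp)); congr (ogerm Vp); apply: spec_sec_eq => q Vq /=.
have [qb ->] := sV q (VU _ Vq) Vq.
rewrite -[LHS]/(loc_mul _ _) loc_mulE; apply: frac_eq; ring.
Qed.

Lemma spec_germ_eq0 (p : SA) (a : A) : spec_germ p a = 0 ->
  exists t, ~ (p : set A) t /\ t * a = 0.
Proof.
rewrite -[0]/(ostalk_zero p) => /spec_sec_germ /= /fracP[t [pt]].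
by rewrite mul0r mulr0 mulr1; exists t.
Qed.

Lemma spec_germ_unit (p : SA) (b : A) :
  is_unit (spec_germ p b) <-> ~ (p : set A) b.
Proof.
split=> [[r] + pb|pb].
  (* If the inverse is [a / c], then [t * (b * a) = t * c] for some [t] outside [p], so [b] in [p]
     would put [t * c] in [p]. *)
  have [a [c [pc e]]] := spec_germ_frac r.
  move=> /(congr1 (fun u => spec_germ p c * u)).
  rewrite mulr1 mulrCA e -spec_germM => /spec_sec_germ /= /fracP[t [pt]].
  rewrite !mulr1 => e'.
  have [[_ _ pM] _ pP] := spec_prime p.
  have : (p : set A) (t * c) by rewrite -e' mulrCA mulrC; apply: pM.
  by move=> /pP[].
have frac_inv : @locally_fraction A (basic_open b) (fun q qb => Defs.frac 1 qb).
  by move=> q qb; exists (basic_open b), 1, b; split=> // q' qb' _; exists qb'.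
have Dp : oset (basic_open b) p by [].
exists (@ogerm SA p (basic_open b) Dp (SpecSec frac_inv)).
rewrite /spec_germ -(@ogerm_res SA p (oT SA) (basic_open b) (fun _ _ => I) I Dp).
rewrite -(rmorphM (ogerm Dp)) -(rmorph1 (ogerm Dp)).
congr (ogerm Dp); apply: spec_sec_eq => q qb /=.
rewrite -[LHS]/(loc_mul _ _) loc_mulE; apply: frac_eq; ring.
Qed.

End SpecStalks.

(* An affine open W seen from inside X: its points are the primes of a ring B,
   and the stalks of X at them are the localizations of B. *)
Record chart (X : ringedSpace) (W : opens X) := Chart {
  cring : comPzRingType;
  cpt : forall z, oset W z -> spec cring;
  csec : {rmorphism cring -> 'O W};
  cpt_surj : forall p, exists z (Wz : oset W z), cpt Wz = p;
  cpt_basis : forall (Z : opens X) z (Wz : oset W z), oset Z z ->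
    exists b, ~ (cpt Wz : set cring) b /\
      forall z' (Wz' : oset W z'), ~ (cpt Wz' : set cring) b -> oset Z z';
  csec_unit : forall z (Wz : oset W z) b,
    is_unit (ogerm Wz (csec b)) <-> ~ (cpt Wz : set cring) b;
  csec_frac : forall z (Wz : oset W z) (r : ostalk z), exists a b,
    ~ (cpt Wz : set cring) b /\ ogerm Wz (csec b) * r = ogerm Wz (csec a);
  csec_eq0 : forall z (Wz : oset W z) a, ogerm Wz (csec a) = 0 ->
    exists t, ~ (cpt Wz : set cring) t /\ t * a = 0
}.

(** The chart properties are those of the spectrum, transported by the bijective, multiplicative
    maps [phi] from its stalks to the stalks of [X]. *)
Lemma affine_chart (X : ringedSpace) (W : opens X) :
  affine_open W -> exists C : chart W, True.
Proof.
move=> [B [f fiso]].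
pose pt z (Wz : oset W z) : Defs.restrict W := exist _ z (mem_set Wz).
pose T := oT (Spec_rs B).
have WT : W `<=` oimage (rm_preim f T : opens (Defs.restrict W)).
  by move=> z Wz; exists (pt z Wz).
pose sec : {rmorphism B -> 'O W} := rs_res WT \o (rm_sharp f T \o @spec_cst B).
pose phi (w : Defs.restrict W) (r : ostalk (f w)) : ostalk (set_val w : X) :=
  ostalk_ext (stalk_map f w r).
have phi_sec z (Wz : oset W z) b :
    phi (pt z Wz) (spec_germ (f (pt z Wz)) b) = ogerm Wz (sec b).
  rewrite /phi /spec_germ stalk_mapE /sec /=.
  have Tz : oset (oimage (rm_preim f T : opens (Defs.restrict W))) z := WT z Wz.
  by rewrite (@ostalk_extE X W (pt z Wz) (rm_preim f T) _ Tz) (ogerm_res WT Tz Wz).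
have phiM w : {morph phi w : r s / r * s} by move=> r s; rewrite /phi !rmorphM.
have phi1 w : phi w 1 = 1 by rewrite /phi !rmorph1.
have phi0 w : phi w 0 = 0 by rewrite /phi !rmorph0.
have phi_inj w : injective (phi w).
  by move=> r s /stalk_ext_inj /(iso_stalk_map_inj fiso).
have phi_surj w r : exists s, phi w s = r.
  have [r' <-] := @stalk_ext_surj X W (O_presheaf X) w r.
  by have [s <-] := iso_stalk_map_surj fiso r'; exists s.
have fbij : bijective f by case: fiso.
unshelve eexists (@Chart X W B (fun z Wz => f (pt z Wz)) sec _ _ _ _ _) => //.
- move=> p; have [g gK Kg] := fbij.
  have Wz : oset W (set_val (g p)) by exact/set_mem/(valP (g p)).
  exists (set_val (g p)), Wz; rewrite -[RHS]Kg; congr (f _); exact: val_inj.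
- move=> Z z Wz Zz.
  have [V [Vz VZ]] := @oimage_small X W Z (pt z Wz) Zz.
  have [D [Dz DV]] := @iso_open_image (Defs.restrict W) (Spec_rs B) f fiso V (pt z Wz) Vz.
  have [b [zb bD]] := spec_basis Dz; exists b; split=> // z' Wz' zb'.
  by apply: VZ; exists (pt z' Wz') => //; apply: DV; exact: bD.
- move=> z Wz b; rewrite -phi_sec -spec_germ_unit; split=> -[r e].
    have [s sE] := phi_surj (pt z Wz) r.
    by exists s; apply: phi_inj; rewrite phiM sE e phi1.
  exists (phi (pt z Wz) r); rewrite -(phiM (pt z Wz)) e; exact (phi1 (pt z Wz)).
- move=> z Wz r; have [s <-] := phi_surj (pt z Wz) r.
  have [a [b [zb e]]] := spec_germ_frac s; exists a, b; split=> //.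
  by rewrite -!phi_sec -(phiM (pt z Wz)) e.
- move=> z Wz a; rewrite -phi_sec -(phi0 (pt z Wz)) => /(phi_inj (pt z Wz)).
  exact: spec_germ_eq0.
Qed.

Section Prime.
Context (A : comPzRingType) (p : spec A).

Lemma spec0 : (p : set A) 0.
Proof. by case: (spec_prime p) => -[]. Qed.

Lemma specM a b : (p : set A) b -> (p : set A) (a * b).
Proof. by case: (spec_prime p) => -[_ _ pM] _ _; apply: pM. Qed.

Lemma spec_prodN a b : ~ (p : set A) (a * b) -> ~ (p : set A) a /\ ~ (p : set A) b.
Proof. by move=> h; split=> pa; apply: h; [rewrite mulrC|]; apply: specM. Qed.

Lemma specX a n : (p : set A) (a ^+ n) -> (p : set A) a.
Proof.
move=> h; apply: contrapT => na; elim: n h => [|n ih].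
  by rewrite expr0; case: (spec_prime p).
by rewrite exprS; case: (spec_prime p) => _ _ pP /pP[].
Qed.

End Prime.

Section Chart.
Context (X : ringedSpace) (W : opens X) (C : chart W).

Definition cbasic (b : cring C) : set X :=
  [set z | exists Wz : oset W z, ~ (cpt C Wz : set (cring C)) b].

(** Quasi-compactness as an induction principle. The [b] with [Q (cbasic b)] form an ideal; if it
    were proper, it would lie in a prime, and the local hypothesis at the corresponding point would
    give a contradiction. *)
Lemma chart_quasi_compact (Q : set X -> Prop) :
  (forall S S', S `<=` S' -> Q S' -> Q S) -> Q set0 ->
  (forall S S', Q S -> Q S' -> Q (S `|` S')) ->
  (forall z (Wz : oset W z), exists b, ~ (cpt C Wz : set (cring C)) b /\ Q (cbasic b)) ->
  Q W.
Proof.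
move=> Qsub Q0 QU Qloc; pose I := [set b | Q (cbasic b)].
have Iid : is_ideal I.
  split=> [|a b Qa Qb|a b Qb].
  - by apply: Qsub Q0 => z [Wz]; apply; exact: spec0.
  - apply: Qsub (QU _ _ Qa Qb) => z [Wz nab].
    have [pa|] := pselect ((cpt C Wz : set (cring C)) a); last by left; exists Wz.
    right; exists Wz => pb; apply: nab.
    by case: (spec_prime (cpt C Wz)) => -[_ pD _] _ _; apply: pD.
  - by apply: Qsub Qb => z [Wz /spec_prodN[_ nb]]; exists Wz.
have [I1|nI1] := pselect (I 1).
  apply: Qsub I1 => z Wz; exists Wz; exact: spec_1N.
have [n|p [Ip _]] := @exists_prime_avoiding _ I 1 Iid; first by rewrite expr1n.
have [z [Wz e]] := cpt_surj p; have [b [nb Qb]] := Qloc z Wz.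
by case: nb; rewrite e; exact: Ip.
Qed.

Lemma section_frac z (Wz : oset W z) (r : ostalk z) :
  exists2 t, is_unit (ogerm Wz t) & exists a, ogerm Wz t * r = ogerm Wz a.
Proof.
have [a [b [nb e]]] := csec_frac C Wz r.
by exists (csec C b); [apply/csec_unit|exists (csec C a)].
Qed.

(** [d] is a denominator of [c] at [z], and [e] cuts out a neighbourhood on which the identity of
    germs persists. *)
Lemma section_local_frac z (Wz : oset W z) (c : 'O W) :
  exists a d e, [/\ ~ (cpt C Wz : set (cring C)) (d * e)
    & forall z' (Wz' : oset W z'), ~ (cpt C Wz' : set (cring C)) (d * e) ->
      ogerm Wz' (csec C d) * ogerm Wz' c = ogerm Wz' (csec C a)].
Proof.
have [a [d [nd]]] := csec_frac C Wz (ogerm Wz c).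
rewrite -ogermM => /ogerm_eq_near[Z [Zz ZE]].
have [e [ne eZ]] := cpt_basis C Wz Zz.
exists a, d, e; split; first exact: spec_mulN.
by move=> z' Wz' /spec_prodN[_ /eZ Zz']; rewrite -ogermM; exact: ZE.
Qed.

(** The section [c] vanishes on some basic open set [cbasic h]. Quasi-compactness gives one power of
    [h] that kills all germs of [c], hence [c] itself. *)
Lemma section_torsion z (Wz : oset W z) (c : 'O W) : ogerm Wz c = 0 ->
  exists2 t, is_unit (ogerm Wz t) & t * c = 0.
Proof.
rewrite -(ogerm0 Wz) => /ogerm_eq_near[Z [Zz ZE]].
have [h [nh hZ]] := cpt_basis C Wz Zz.
pose Q (S : set X) := exists n, forall z (Wz : oset W z), S z ->
  ogerm Wz (csec C h ^+ n * c) = 0.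
have [n nP] : Q W.
  apply: chart_quasi_compact => [S S' SS' [n nP]||S S' [n nP] [n' nP']|y Wy].
  - by exists n => y Wy /SS'; exact: nP.
  - by exists 0%N.
  - exists (n + n')%N => y Wy [/(nP y Wy)|/(nP' y Wy)] e.
      by rewrite exprD (mulrC (csec C h ^+ n)) -mulrA ogermM e mulr0.
    by rewrite exprD -mulrA ogermM e mulr0.
  - have [a [d [e [nde deE]]]] := section_local_frac Wy c.
    exists (d * e); split=> //.
    (* On [cbasic (d * e)] the section is [a / d], so [a] vanishes at the primes avoiding
       [d * e * h]. *)
    have [q|n] := @prime_annihilator _ a (d * e * h).
      move=> /spec_prodN[qde qh]; have [x [Wx xq]] := cpt_surj q.
      subst q; apply: (csec_eq0 (Wz := Wx)).
      rewrite -deE // (ZE x Wx Wx) ?ogerm0 ?mulr0 //; exact: hZ qh.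
    move=> nP; exists n => x Wx [Wx' nx].
    rewrite (Prop_irrelevance Wx' Wx) in nx.
    have [nd ne] := spec_prodN nx.
    have ude : is_unit (ogerm Wx (csec C ((d * e) ^+ n * d))).
      apply/csec_unit/spec_mulN => //; exact: contra_not (@specX _ _ _ _) nx.
    apply: (unit_mulI ude); rewrite mulr0 rmorphM !ogermM mulrACA deE //.
    rewrite -!ogermM -!rmorphXn -!rmorphM.
    have -> : (d * e) ^+ n * h ^+ n * a = (d * e * h) ^+ n * a.
      by rewrite [in RHS]exprMn.
    by rewrite nP rmorph0 ogerm0.
exists (csec C h ^+ n); first by rewrite ogermX; apply/is_unitX/csec_unit.
by apply: section_eq0 => y Wy; exact: nP.
Qed.

(** Locally [g] is a fraction [a / d]. If [g] is invertible nowhere, [d * e * a] lies in all primes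
    and is nilpotent; then [g] is nilpotent near each point, hence zero by reducedness. *)
Lemma section_unit_somewhere (g : 'O W) :
  (forall (U : opens X) (s : 'O U) n, s ^+ n = 0 -> s = 0) -> g != 0 ->
  exists z (Wz : oset W z), is_unit (ogerm Wz g).
Proof.
move=> red /eqP gn0; apply: contrapT => ng; apply: gn0; apply: section_eq0 => z Wz.
have [a [d [e [nde deE]]]] := section_local_frac Wz g.
have [n nP] : exists n, (d * e * a) ^+ n = 0.
  apply: contrapT => /forallNP nnil.
  have [|q [_ /spec_prodN[qde qa]]] :=
      @exists_prime_avoiding _ [set 0 : cring C] (d * e * a) _ nnil.
    by split=> //= [x y -> ->|x y ->]; rewrite ?addr0 ?mulr0.
  have [x [Wx xq]] := cpt_surj q; subst q; case: ng; exists x, Wx.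
  apply: (@is_unit_mul _ _ (ogerm Wx (csec C d))).
  by rewrite mulrC deE //; apply/csec_unit.
have [Z [Zz Zunit]] := ogerm_unit_near (proj2 (csec_unit Wz (d * e)) nde).
have Iz : oset (opensI W Z) z by [].
rewrite -(ogerm_res (@opensIl _ W Z) Wz Iz).
suff -> : rs_res (@opensIl _ W Z) g = 0 by exact: ogerm0.
apply: (red _ _ n); apply: section_eq0 => x [Wx Zx].
rewrite ogermX (ogerm_res (@opensIl _ W Z) Wx) -ogermX.
have nx : ~ (cpt C Wx : set (cring C)) (d * e) by apply/csec_unit/Zunit.
have [nd _] := spec_prodN nx.
have ude : is_unit (ogerm Wx (csec C ((d * e) ^+ n * d ^+ n))).
  rewrite rmorphM !rmorphXn ogermM !ogermX.
  by apply: is_unitM; apply: is_unitX; apply/csec_unit.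
apply: (unit_mulI ude); rewrite mulr0 rmorphM !rmorphXn !ogermM !ogermX.
by rewrite -mulrA -exprMn deE // -exprMn -ogermM -rmorphM -ogermX -rmorphXn nP rmorph0 ogerm0.
Qed.

End Chart.

(** * Generic flatness *)

Section GermComb.
Context (X : ringedSpace) (F : omodule X) (x : X) (U : opens X) (Ux : oset U x).
Context (n : nat) (s : 'I_n -> mstalk F x).

Definition germ_comb (v : 'rV['O U]_n) : mstalk F x :=
  \sum_i ogerm Ux (v 0 i) *: s i.

Lemma germ_comb_zmod : zmod_morphism germ_comb.
Proof.
move=> u v; rewrite /germ_comb -sumrB; apply: eq_bigr => i _.
by rewrite !mxE rmorphB scalerBl.
Qed.
HB.instance Definition _ := GRing.isZmodMorphism.Build
  'rV['O U]_n (mstalk F x) germ_comb germ_comb_zmod.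

Lemma germ_combZ b v : germ_comb (b *: v) = ogerm Ux b *: germ_comb v.
Proof.
rewrite scaler_sumr; apply: eq_bigr => i _.
by rewrite mxE ogermM scalerA.
Qed.

End GermComb.

(** The elements [b] whose multiplication preserves the span are closed under sums and products.
    They include the image of [A], and the generators by [mshift]. *)
Lemma finite_type_span (A B : comPzRingType) (iota : {rmorphism A -> B}) n
    (N : set 'rV[B]_n) d (gen : 'I_d -> B) (T : monomials 'rV[B]_n (range gen)) :
  N 0 -> (forall u v, N u -> N v -> N (u + v)) -> (forall b u, N u -> N (b *: u)) ->
  (forall S : set B, (forall r, S (iota r)) -> (forall i, S (gen i)) ->
    (forall a b, S a -> S b -> S (a + b)) ->
    (forall a b, S a -> S b -> S (a * b)) -> forall a, S a) ->
  (forall i, exists x : T, mval x = delta_mx 0 i) ->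
  forall v, in_span iota N (fun _ : T => True) v.
Proof.
move=> N0 ND NZ gens Tdelta.
have in_spanM b v : in_span iota N (fun _ : T => True) v ->
    in_span iota N (fun _ : T => True) (b *: v).
  move: b v; apply: (gens (fun b => forall v, in_span iota N (fun _ : T => True) v ->
    in_span iota N (fun _ : T => True) (b *: v))).
  - by move=> a v; apply: in_spanZ.
  - move=> i v [s [a [us _ Nv]]].
    apply: (in_span_mod ND (v := gen i *: comb iota s a)).
      by rewrite -scalerBr; apply: NZ.
    rewrite scaler_sumr; apply: in_span_sum => // x _.
    rewrite scalerA mulrC -scalerA; apply: in_spanZ => //.
    by have [y <-] := mshift x (imageT gen i); exact: in_span_mval.
  - by move=> a b ha hb v hv; rewrite scalerDl; apply: in_spanD => //; [apply: ha|apply: hb].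
  - by move=> a b ha hb v hv; rewrite -scalerA; apply/ha/hb.
move=> v; rewrite (row_sum_delta v); apply: in_span_sum => // i _.
by apply: in_spanM; have [x <-] := Tdelta i; exact: in_span_mval.
Qed.

Section GenericFlatness.
Context (X Y : ringedSpace) (f : rsMorphism X Y) (F : omodule X).
Context (V : opens Y) (CV : chart V).

Definition flat_at (x : X) := equational (rscal (stalk_map f x) (mstalk F x)).

(** Every nonzero [g] must have a suitable nonzero multiple. This makes finite unions accessible
    although nonzero sections may have product zero. *)
Definition generically_flat (S : set X) := forall g : 'O V, g != 0 ->
  exists h, g * h != 0 /\ forall x (Vx : oset V (f x)), S x ->
    is_unit (ogerm Vx (g * h)) -> flat_at x.

Lemma generically_flat_sub S S' :
  S `<=` S' -> generically_flat S' -> generically_flat S.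
Proof.
move=> SS' h g /h[g' [gg' gP]]; exists g'; split=> // x Vx /SS'; exact: gP.
Qed.

Lemma generically_flat0 : generically_flat set0.
Proof. by move=> g gn0; exists 1; rewrite mulr1. Qed.

Lemma generically_flatU S S' :
  generically_flat S -> generically_flat S' -> generically_flat (S `|` S').
Proof.
move=> hS hS' g /hS[h [gh hP]]; have [h' [ghh' hP']] := hS' _ gh.
exists (h * h'); rewrite mulrA; split=> // x Vx [Sx|Sx] u; last exact: hP' u.
by apply: (hP x Vx Sx); move: u; rewrite ogermM => /is_unit_mul.
Qed.

Context (U : opens X) (CU : chart U) (UV : U `<=` rm_preim f V).
Local Notation iota := (rs_res UV \o rm_sharp f V).
Hypothesis ft : finite_type_ring (rs_res UV \o rm_sharp f V).
Hypothesis Fcoh : coherent F.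
Hypothesis redV : forall (a : 'O V) n, a ^+ n = 0 -> a = 0.

(* F has a presentation near x0 whose relations, after clearing denominators,
   are sections over all of U. *)
Lemma local_presentation (x0 : X) (Ux0 : oset U x0) :
  exists (c : cring CU) (n m : nat) (b : 'I_m -> 'I_n -> 'O U)
    (s : forall x, 'I_n -> mstalk F x),
    ~ (cpt CU Ux0 : set (cring CU)) c /\
    forall x (Ux : oset U x), ~ (cpt CU Ux : set (cring CU)) c ->
      [/\ forall z, exists a : 'I_n -> ostalk x, z = \sum_i a i *: s x i,
          forall j, \sum_i ogerm Ux (b j i) *: s x i = 0
        & forall a : 'I_n -> ostalk x, \sum_i a i *: s x i = 0 ->
          exists d : 'I_m -> ostalk x,
            forall i, a i = \sum_j d j * ogerm Ux (b j i)].
Proof.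
have [/(_ x0)[Z0 [n [s [Z0x0 sgen]]]] /(_ _ _ s)/(_ x0 Z0x0)] := Fcoh.
move=> [Z [ZZ0 [m [k [Zx0 krel kgen]]]]].
have [t ut tP] : exists2 t, is_unit (ogerm Ux0 t) & forall p : 'I_m * 'I_n,
    exists b, ogerm Ux0 t * ogerm Zx0 (k p.1 p.2) = ogerm Ux0 b.
  apply: (@common_unit _ _ (ogerm Ux0)) => [p t t' [b e]|p].
    by exists (t * b); rewrite !ogermM -mulrA e.
  exact: (section_frac CU).
have /choice[b bE] := tP.
(* [c1] keeps the points in [Z], [c2] keeps [t] invertible, and [c3] preserves the identities
   [t k = b] of germs. *)
have [c1 [nc1 c1Z]] := cpt_basis CU Ux0 Zx0.
have [Zt [Ztx0 ZtP]] := ogerm_unit_near ut.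
have [c2 [nc2 c2Z]] := cpt_basis CU Ux0 Ztx0.
have [c3 uc3 c3P] : exists2 c, is_unit ((ogerm Ux0 \o csec CU) c) &
    forall (p : 'I_m * 'I_n) x (Ux : oset U x) (Zx : oset Z x),
      ~ (cpt CU Ux : set (cring CU)) c ->
      ogerm Ux t * ogerm Zx (k p.1 p.2) = ogerm Ux (b p).
  apply: common_unit => [p c c' h x Ux Zx /spec_prodN[_]|p]; first exact: h.
  have Ix0 : oset (opensI U Z) x0 by [].
  have := bE p.
  rewrite -(ogerm_res (@opensIl _ U Z) Ux0 Ix0) -(ogerm_res (@opensIr _ U Z) Zx0 Ix0).
  rewrite -ogermM => /ogerm_eq_near[W [Wx0 WE]].
  have [c [nc cW]] := cpt_basis CU Ux0 Wx0.
  exists c; first exact/csec_unit.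
  move=> x Ux Zx /cW Wx; have Ix : oset (opensI U Z) x by [].
  rewrite -(WE x Ix Ux Wx) ogermM.
  by rewrite (ogerm_res (@opensIl _ U Z) Ux Ix) (ogerm_res (@opensIr _ U Z) Zx Ix).
have nc3 : ~ (cpt CU Ux0 : set (cring CU)) c3 by apply/csec_unit.
(* The value [0] outside [Z] is a placeholder, since [c1] keeps the points considered inside [Z]. *)
pose sx x i : mstalk F x :=
  if pselect (oset Z x) is left Zx then mgerm (ZZ0 x Zx) (s i) else 0.
exists (c1 * c2 * c3), n, m, (fun j i => b (j, i)), sx.
split; first by do 2?apply: spec_mulN.
move=> x Ux /spec_prodN[/spec_prodN[/c1Z Zx /c2Z Ztx] nc3x].
have sxE i : sx x i = mgerm (ZZ0 x Zx) (s i).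
  by rewrite /sx; case: pselect => // Zx'; rewrite (Prop_irrelevance Zx' Zx).
have tkb j i : ogerm Ux t * ogerm Zx (k j i) = ogerm Ux (b (j, i)).
  exact: (c3P (j, i)).
have [t' tt'] := ZtP x Ux Ztx.
split=> [z|j|a].
- have [a ->] := sgen x (ZZ0 x Zx) z; exists a.
  by apply: eq_bigr => i _; rewrite sxE.
- transitivity (ogerm Ux t *: \sum_i ogerm Zx (k j i) *: sx x i).
    by rewrite scaler_sumr; apply: eq_bigr => i _; rewrite scalerA tkb.
  rewrite -[RHS](scaler0 _ (ogerm Ux t)); congr (_ *: _).
  transitivity (mgerm Zx (\sum_i k j i *: om_res F ZZ0 (s i))); last first.
    by rewrite krel -(mstalk_zeroE F Zx).
  rewrite (big_morph (mgerm (F := F) Zx) (id1 := 0) (op1 := +%R)).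
  + apply: eq_bigr => i _; rewrite sxE -(mgerm_res ZZ0 (ZZ0 x Zx) Zx).
    exact: (mstalk_scaleE Zx).
  + by move=> u v; rewrite -(mstalk_addE Zx).
  + by rewrite -(mstalk_zeroE F Zx).
- under eq_bigr => i _ do rewrite sxE.
  (* The relations [b] are [t] times the relations [k], whence the factor [t'] inverse to [t]. *)
  move=> /(kgen x Zx)[d dE]; exists (fun j => d j * t') => i.
  rewrite dE; apply: eq_bigr => j _.
  by rewrite -tkb -mulrA [t' * _]mulrA [t' * _]mulrC tt' mul1r.
Qed.

Lemma generically_flat_near (x0 : X) (Ux0 : oset U x0) :
  exists c, ~ (cpt CU Ux0 : set (cring CU)) c /\ generically_flat (cbasic c).
Proof.
have [c [n [m [b [s [nc pres]]]]]] := local_presentation Ux0.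
exists c; split=> // g gn0.
have [d [gen gens]] := ft.
have [T Tdelta] := monomials_exist (fun i : 'I_n => delta_mx 0 i : 'rV['O U]_n) gen.
(* At the points of [cbasic c] this submodule becomes, after localization, the kernel of
   [germ_comb]. *)
pose N : set 'rV['O U]_n :=
  [set v | exists e : 'I_m -> 'O U, forall i, v 0 i = \sum_j e j * b j i].
have N0 : N 0.
  by exists (fun=> 0) => i; rewrite mxE big1 // => j _; rewrite mul0r.
have ND u v : N u -> N v -> N (u + v).
  move=> [e eE] [e' eE']; exists (fun j => e j + e' j) => i.
  by rewrite mxE eE eE' -big_split; apply: eq_bigr => j _; rewrite mulrDl.
have NZ a u : N u -> N (a *: u).
  move=> [e eE]; exists (fun j => a * e j) => i.
  by rewrite mxE eE mulr_sumr; apply: eq_bigr => j _; rewrite mulrA.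
have span := finite_type_span N0 ND NZ gens Tdelta.
have [h [std [ghn0 stdP]]] := standard_basis_exists N0 ND NZ redV span gn0.
exists h; split=> // x Vx [Ux ncx] ugh.
have [sgen brel bgen] := pres x Ux ncx.
(* Sections over [V] and [U] play the roles of [A] and [B], their stalks those of [R] and [S]. *)
apply: (@equational_localization _ _ _ _ N _ T N0 ND NZ _ _ stdP _ _ _ _
  (ogerm Vx) (ogerm Ux) _ ugh _ (germ_comb Ux (s x))).
- move=> a; rewrite /= stalk_mapE.
  exact: (esym (ogerm_res UV (Vx : oset (rm_preim f V) x) Ux _)).
- exact: (section_frac CV).
- exact: germ_combZ.
- move=> u [e eE]; rewrite /= /germ_comb.
  under eq_bigr => i _ do rewrite eE rmorph_sum scaler_suml.
  rewrite exchange_big /= big1 // => j _.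
  under eq_bigr => i _ do rewrite rmorphM -scalerA.
  by rewrite -scaler_sumr brel scaler0.
- move=> z; have [a ->] := sgen z.
  have [t ut tP] : exists2 t, is_unit (ogerm Ux t) & forall i,
      exists v, ogerm Ux t * a i = ogerm Ux v.
    apply: (@common_unit _ _ (ogerm Ux)) => [i t t' [v e]|i].
      by exists (t * v); rewrite !ogermM -mulrA e.
    exact: (section_frac CU).
  have /choice[v vE] := tP; exists t => //; exists (\row_i v i).
  rewrite scaler_sumr; apply: eq_bigr => i _.
  by rewrite mxE scalerA -vE.
(* The germs [e] have a common denominator [t]. The resulting identity of sections holds only at
   [x], so [section_torsion] supplies a further factor [t']. *)
- move=> u /bgen[e eE].
  have [t ut tP] : exists2 t, is_unit (ogerm Ux t) & forall j,
      exists v, ogerm Ux t * e j = ogerm Ux v.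
    apply: (@common_unit _ _ (ogerm Ux)) => [j t t' [v ev]|j].
      by exists (t * v); rewrite !ogermM -mulrA ev.
    exact: (section_frac CU).
  have /choice[v vE] := tP.
  have [t' ut' t'P] : exists2 t', is_unit (ogerm Ux t') & forall i,
      t' * (t * u 0 i - \sum_j v j * b j i) = 0.
    apply: (@common_unit _ _ (ogerm Ux)) => [i a a' e0|i].
      by rewrite -mulrA e0 mulr0.
    apply: (section_torsion CU); rewrite rmorphB rmorphM rmorph_sum /=.
    apply/eqP; rewrite subr_eq0; apply/eqP; rewrite eE mulr_sumr.
    apply: eq_bigr => j _; rewrite -[RHS]/(ogerm Ux (v j * b j i)) ogermM -vE.
    exact: mulrA.
  exists (t' * t); first by rewrite rmorphM; exact: is_unitM.
  exists (fun j => t' * v j) => i; rewrite mxE -mulrA.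
  have := t'P i; rewrite mulrBr => /eqP; rewrite subr_eq0 => /eqP ->.
  by rewrite mulr_sumr; apply: eq_bigr => j _; rewrite mulrA.
Qed.

Lemma generically_flat_chart : generically_flat U.
Proof.
apply: (chart_quasi_compact (C := CU)).
- exact: generically_flat_sub.
- exact: generically_flat0.
- exact: generically_flatU.
- exact: generically_flat_near.
Qed.

End GenericFlatness.

(** * Passage to restrictions and conclusion *)

Lemma equational_iso (R R' : comPzRingType) (M : lmodType R) (M' : lmodType R')
    (rho : {rmorphism R -> R'}) (iota : M -> M') :
  injective rho -> (forall r', exists r, rho r = r') ->
  injective iota -> (forall m', exists m, iota m = m') ->
  {morph iota : u v / u + v} -> (forall r m, iota (r *: m) = rho r *: iota m) ->
  equational M' -> equational M.
Proof.
move=> rinj rsurj iinj isurj iD iZ M'eq J L m r rel.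
have i0 : iota 0 = 0 by rewrite -(scale0r 0) iZ rmorph0 scale0r.
have isum (I : finType) (F : I -> M) : iota (\sum_i F i) = \sum_i iota (F i).
  exact: (big_morph iota iD i0).
have [l|K [n' [a' [mE aE]]]] := M'eq J L (iota \o m) (fun l j => rho (r l j)).
  transitivity (iota (\sum_j r l j *: m j)); last by rewrite rel.
  by rewrite isum; apply: eq_bigr => j _; rewrite iZ.
have /choice[n nE] : forall k, exists n, iota n = n' k by move=> k; exact: isurj.
have /choice[a aE'] : forall p : J * K, exists a, rho a = a' p.1 p.2.
  by move=> p; exact: rsurj.
exists K, n, (fun j k => a (j, k)); split=> [j|l k].
  apply: iinj; rewrite isum -[LHS]/((iota \o m) j) mE; apply: eq_bigr => k _.
  by rewrite iZ aE' nE.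
apply: rinj; rewrite rmorph0 -(aE l k) rmorph_sum; apply: eq_bigr => j _.
by rewrite rmorphM aE'.
Qed.

(** The bijections from the stalks of the restrictions to the original stalks commute with the stalk
    maps, so the criterion transfers. *)
Lemma flat_at_restrict (X Y : ringedSpace) (f : rsMorphism X Y) (F : omodule X)
    (U : opens Y) (x : Defs.restrict (rm_preim f U)) :
  flat_at f F (set_val x) ->
  equational (rscal (stalk_map (restrict_mor f U) x)
    (mstalk (restrict_mod (rm_preim f U) F) x)).
Proof.
set y : Defs.restrict U := restrict_mor f U x.
apply: (@equational_iso (ostalk y) (ostalk (set_val y : Y))
  (rscal (stalk_map (restrict_mor f U) x) (mstalk (restrict_mod (rm_preim f U) F) x))
  (rscal (stalk_map f (set_val x)) (mstalk F (set_val x : X)))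
  (@ostalk_ext Y U y : {rmorphism ostalk y -> ostalk (set_val y : Y)})
  (@mstalk_ext X (rm_preim f U) x F)).
- exact: (@stalk_ext_inj Y U (O_presheaf Y)).
- exact: (@stalk_ext_surj Y U (O_presheaf Y)).
- exact: (@stalk_ext_inj X (rm_preim f U) (om_presheaf F)).
- exact: (@stalk_ext_surj X (rm_preim f U) (om_presheaf F)).
- exact: mstalk_extD.
move=> r m.
transitivity (ostalk_ext (stalk_map (restrict_mor f U) x r) *: mstalk_ext m).
  exact: mstalk_extZ.
suff -> : ostalk_ext (stalk_map (restrict_mor f U) x r) =
  stalk_map f (set_val x) (@ostalk_ext Y U y r) by [].
have [V [Vy [s ->]]] := stalkP r.
rewrite -/(ogerm Vy s) stalk_mapE.
have Vy' : oset (oimage V) (set_val y : Y) by exact: imageP.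
have Vx' : oset (oimage (rm_preim (restrict_mor f U) V)) (set_val x : X).
  exact: imageP.
rewrite (@ostalk_extE _ _ _ _ _ Vx') (@ostalk_extE Y U y V Vy Vy').
rewrite (@stalk_mapE X Y f (set_val x) _ Vy').
exact: (ogerm_res (@restrict_preim X Y f U V)).
Qed.

Lemma generically_flat_bigU (X Y : ringedSpace) (f : rsMorphism X Y)
    (F : omodule X) (V : opens Y) n (U : 'I_n -> opens X) :
  (forall i, generically_flat f F V (U i)) ->
  generically_flat f F V (\bigcup_i U i).
Proof.
move=> Uflat.
have h (r : seq 'I_n) : generically_flat f F V [set x | exists2 i, i \in r & oset (U i) x].
  elim: r => [|i r ih].
    by apply: (generically_flat_sub _ (@generically_flat0 _ _ f F V)) => x [i]; rewrite in_nil.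
  apply: (generically_flat_sub _ (generically_flatU (Uflat i) ih)) => x [j].
  by rewrite inE => /orP[/eqP->|jr Ux]; [left|right; exists j].
apply: (generically_flat_sub _ (h (enum 'I_n))) => x [i _ Ux]; exists i => //.
exact: mem_enum.
Qed.

Lemma unit_locus_open (X : ringedSpace) (V : opens X) (g : 'O V) :
  open [set x | exists Vx : oset V x, is_unit (ogerm Vx g)].
Proof.
set S := [set x | _].
suff -> : S = \bigcup_(W in [set W : opens X | W `<=` S]) W.
  by apply: bigcup_open => W _; exact: open_oset.
apply/seteqP; split=> [x [Vx /ogerm_unit_near[W [Wx WP]]]|x [W WS /WS]//].
exists (opensI V W) => // z [Vz Wz]; exists Vz; exact: WP.
Qed.

Theorem theorem3p7p1 (X Y : scheme) (f : schemeMorphism X Y) (F : omodule X) :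
  noetherian_scheme X -> noetherian_scheme Y ->
  reduced Y -> (exists y : Y, True) ->
  finite_type f -> coherent F ->
  exists U : opens Y,
    (exists y : Y, oset U y) /\
    flat_over (restrict_mor f U) (restrict_mod (rm_preim f U) F).
Proof.
move=> _ _ redY [y0 _] [I [V [Vcov Vaff Vft]]] Fcoh.
have [i Vy0] := Vcov y0.
have [CV _] := affine_chart (Vaff i).
have [n [U [Ucov Uaff Uft]]] := Vft i.
have Vflat : generically_flat f F (V i) (\bigcup_j U j).
  apply: generically_flat_bigU => j; have [CU _] := affine_chart (Uaff j).
  have [UV ft] := Uft j.
  exact: (generically_flat_chart CV CU ft Fcoh (@redY (V i))).
(* The germ of [1] at [y0] is nonzero: a prime contains [0], so no denominator is zero. *)
have V1 : (1 : 'O (V i)) != 0.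
  apply/eqP => e; have [|t [nt]] := @csec_eq0 _ _ CV _ Vy0 1.
    by rewrite rmorph1 e; exact: ogerm0.
  by rewrite mulr1 => t0; apply: nt; rewrite t0; exact: spec0.
have [h []] := Vflat 1 V1; rewrite mul1r => hn0 hflat.
(* The locus where [h] is invertible; it is non-empty because [h] is nonzero and [Y] is reduced. *)
exists (Opens (unit_locus_open h)); split.
  have [y [Vy uh]] := section_unit_somewhere CV redY hn0.
  by exists y, Vy.
move=> x; apply/flat_of_equational/flat_at_restrict.
have [Vx uh] : oset (Opens (unit_locus_open h)) (f (set_val x)).
  exact/set_mem/(valP x).
apply: hflat uh; have [j Ux] := proj1 (Ucov (set_val x)) Vx.
by exists j.
Qed.
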